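(* Let $(M,\lambda,J)$ be a contact triad and let $w:\mathbb{R}\times S^1\to M$ be a massless contact instanton, i.e. a contact instanton with $E^\pi(w)=0$. Let $T$ and $Q$ be its asymptotic contact action and asymptotic contact charge. Then there exists a leaf of the Reeb foliation such that we can write $w(\tau,t)=\gamma(-Q\,\tau+T\,t)$, where $\gamma$ is a parameterization of the leaf satisfying $\dot\gamma=X_\lambda(\gamma)$. In particular, if $T\neq 0$, then $\gamma$ is a closed Reeb orbit of $X_\lambda$ with period $T$. If in addition $Q=0$, then $w$ is invariant under $\tau$-translations. If $T=0$ and $Q\neq 0$, the leaf need not be closed but must be the image of an immersion of $\mathbb{R}$.
   Context: Contact triad: $M$ is a $(2n+1)$-dimensional manifold with a co-oriented contact structure $\xi=\ker\lambda$, where $\lambda$ is a contact one-form. The Reeb vector field $X_\lambda$ is determined by $\lambda(X_\lambda)=1$ and $X_\lambda\rfloor d\lambda=0$; the Reeb foliation is the foliation of $M$ by the trajectories of $X_\lambda$. $J:\xi\to\xi$ is an almost complex structure on $\xi$ ($J^2=-\mathrm{id}$) compatible with $d\lambda$, in the sense that $g_\xi=d\lambda(\cdot,J\cdot)$ makes $(\xi,J,g_\xi)$ a Hermitian vector bundle; $J$ is extended to $TM$ by $JX_\lambda=0$. The triple $(M,\lambda,J)$ is called a contact triad, and $M$ carries the triad metric $g_\lambda=g_\xi+\lambda\otimes\lambda$. $\pi:TM\to\xi$ is the projection with respect to the splitting $TM=\xi\oplus\mathbb{R}\{X_\lambda\}$. $S^1=\mathbb{R}/\mathbb{Z}$, and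 the cylinder $\mathbb{R}\times S^1$ has coordinates $(\tau,t)$, the flat metric $d\tau^2+dt^2$ and the standard complex structure $j$ with $j\,\partial_\tau=\partial_t$. A contact instanton is a smooth map $w$ satisfying $\overline{\partial}^\pi w:=\frac12(\pi\,dw+J\,\pi\,dw\circ j)=0$ and $d(w^*\lambda\circ j)=0$. The $\pi$-harmonic energy is $E^\pi(w)=\frac12\int|d^\pi w|^2$ with $d^\pi w=\pi\,dw$, the integral being over the domain of $w$. The asymptotic contact action and asymptotic contact charge are $$T=\frac12\int_{[0,\infty)\times S^1}|d^\pi w|^2+\int_{\{0\}\times S^1}(w|_{\{0\}\times S^1})^*\lambda,\qquad Q=\int_{\{0\}\times S^1}w^*\lambda\circ j,$$ where in the second formula the one-form $w^*\lambda\circ j$ is restricted to the circle $\{0\}\times S^1$. (For a massless instanton the first term of $T$ vanishes.)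
   Formalization: The formal theorem also assumes that |dw| is bounded on R×S^1 (flat and triad metrics); without it the claim fails, e.g. w=(0,0,cosh(2πτ)cos(2πt)) in standard contact R^3 has T=Q=0 but is not constant. The bound is necessary for the conclusion. *)

(* Defs.v *)
From HB Require Import structures.
From mathcomp Require Import all_boot all_order all_algebra.
From mathcomp Require Import all_classical all_reals all_analysis.
Import Order.TTheory GRing.Theory Num.Theory.
Import numFieldNormedType.Exports.

Set Implicit Arguments.
Unset Strict Implicit.
Unset Printing Implicit Defensive.

Local Open Scope classical_set_scope.
Local Open Scope ring_scope.

Section SmoothCalculus.
Context {R : realType}.

(* C^k on an open set U of a finite-dimensional space: all iterated
   directional derivatives up to order k exist and are continuous on U. *)
Fixpoint Ck (V W : normedModType R) (k : nat) (U : set V) (f : V -> W) : Prop :=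
  match k with
  | 0 => forall x, U x -> {for x, continuous f}
  | k'.+1 => (forall x, U x -> differentiable f x) /\
             (forall v : V, Ck k' U (fun x => 'D_v f x))
  end.

Definition smooth_on (V W : normedModType R) (U : set V) (f : V -> W) : Prop :=
  forall k, Ck k U f.

(* (d alpha)_x (u, v) for a one-form alpha on V, u and v being extended to
   constant (hence commuting) vector fields. *)
Definition ext_d (V : normedModType R) (alpha : V -> V -> R) (x u v : V) : R :=
  'D_u (fun y => alpha y v : R^o) x - 'D_v (fun y => alpha y u : R^o) x.

End SmoothCalculus.

Record chart (R : realType) (m : nat) (M : topologicalType) := Chart {
  cdom : set M;
  cmap : M -> 'rV[R]_m.+1;
  cinv : 'rV[R]_m.+1 -> M
}.

Definition cimg (R : realType) (m : nat) (M : topologicalType)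
  (c : chart R m M) : set 'rV[R]_m.+1 := cmap c @` cdom c.

Definition is_chart (R : realType) (m : nat) (M : topologicalType)
  (c : chart R m M) : Prop :=
  [/\ open (cdom c), open (cimg c),
      forall p, cdom c p -> cinv c (cmap c p) = p,
      forall p, cdom c p -> {for p, continuous (cmap c)} &
      forall x, cimg c x -> {for x, continuous (cinv c)}].

(* Smooth manifolds of dimension m.+1.  [chart_at p] is a preferred chart
   around p; it only serves to represent the tangent space at p. *)
Record manifold (R : realType) (m : nat) := Manifold {
  carrier :> topologicalType;
  atlas : set (chart R m carrier);
  chart_at : carrier -> chart R m carrier;
  manifold_hausdorff : hausdorff_space carrier;
  manifold_second_countable : @second_countable carrier;
  atlas_chart : forall c, atlas c -> is_chart c;
  atlas_compat : forall c d, atlas c -> atlas d ->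
    smooth_on (cmap c @` (cdom c `&` cdom d)) (cmap d \o cinv c);
  chart_at_atlas : forall p, atlas (chart_at p);
  chart_at_dom : forall p, cdom (chart_at p) p
}.

Section Manifolds.
Context {R : realType} {m : nat} {M : manifold R m}.
Local Notation E := 'rV[R]_m.+1.

(* The tangent space T_pM is represented by E, a tangent vector at p being
   given by its components in the chart [chart_at p].  A vector field is thus
   a function M -> E, a one-form is a function M -> E -> R, etc. *)

(* the differential d f_z : V -> T_{f z} M *)
Definition dmap (V : normedModType R) (f : V -> M) (z v : V) : E :=
  'D_v (cmap (chart_at (f z)) \o f) z.

(* components in the chart c of a tangent vector v at p *)
Definition tcomp (c : chart R m M) (p : M) (v : E) : E :=
  'D_v (cmap c \o cinv (chart_at p)) (cmap (chart_at p) p).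

Definition pullback (V : normedModType R) (f : V -> M) (alpha : M -> E -> R)
  (z v : V) : R := alpha (f z) (dmap f z v).

Definition smooth_map (V : normedModType R) (f : V -> M) : Prop :=
  continuous f /\
  forall c, atlas c -> smooth_on (f @^-1` cdom c) (cmap c \o f).

Definition smooth_one_form (alpha : M -> E -> R) : Prop :=
  (forall p, scalar (alpha p)) /\
  forall c, atlas c -> forall v : E,
    smooth_on (cimg c) (fun x => pullback (cinv c) alpha x v : R^o).

Definition smooth_vector_field (X : M -> E) : Prop :=
  forall c, atlas c ->
    smooth_on (cimg c) (fun x => tcomp c (cinv c x) (X (cinv c x))).

Definition smooth_endomorphism (J : M -> E -> E) : Prop :=
  (forall p, linear (J p)) /\
  forall c, atlas c -> forall v : E,
    smooth_on (cimg c)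
      (fun x => tcomp c (cinv c x) (J (cinv c x) (dmap (cinv c) x v))).

Definition dform (alpha : M -> E -> R) (p : M) (u v : E) : R :=
  ext_d (pullback (cinv (chart_at p)) alpha) (cmap (chart_at p) p) u v.

Definition immersion (c : R -> M) : Prop :=
  smooth_map (c : R^o -> M) /\ forall s : R, dmap (c : R^o -> M) s 1 != 0.

(* I is an open interval, and gamma' = X(gamma) on I.  The values of gamma
   outside I are irrelevant. *)
Definition integral_curve (X : M -> E) (I : set R) (gamma : R -> M) : Prop :=
  [/\ open I, is_interval I &
    forall s, I s -> {for s, continuous gamma} /\
      is_derive (s : R^o) (1 : R^o)
        (cmap (chart_at (gamma s)) \o gamma : R^o -> E) (X (gamma s))].

(* the trajectory of X through p *)
Definition trajectory (X : M -> E) (p : M) : set M :=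
  [set q | exists I gamma a b, [/\ integral_curve X I gamma,
     I a, I b, gamma a = p & gamma b = q]].

(* a leaf of the one-dimensional foliation spanned by X *)
Definition leaf (X : M -> E) (L : set M) : Prop :=
  exists p, L = trajectory X p.

Definition leaf_parameterization (X : M -> E) (L : set M)
  (I : set R) (gamma : R -> M) : Prop :=
  integral_curve X I gamma /\ gamma @` I = L.

Definition closed_orbit (X : M -> E) (P : R) (gamma : R -> M) : Prop :=
  integral_curve X setT gamma /\ forall s, gamma (s + P) = gamma s.

Definition closed_leaf (X : M -> E) (L : set M) : Prop :=
  exists P gamma, [/\ P != 0, closed_orbit X P gamma & range gamma = L].

End Manifolds.

Section ContactTriad.
Context {R : realType} {n : nat} {M : manifold R n.*2}.
Local Notation E := 'rV[R]_(n.*2).+1.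
Implicit Types (lam : M -> E -> R) (X : M -> E) (J : M -> E -> E) (p : M).

(* xi = ker lam is a hyperplane field on which d lam is nondegenerate. *)
Definition contact_form lam : Prop :=
  [/\ smooth_one_form lam,
      forall p, exists v, lam p v != 0 &
      forall p v, lam p v = 0 ->
        (forall u, lam p u = 0 -> dform lam p v u = 0) -> v = 0].

(* These two equations determine X when lam is a contact form. *)
Definition reeb_field lam X : Prop :=
  [/\ smooth_vector_field X,
      forall p, lam p (X p) = 1 &
      forall p v, dform lam p (X p) v = 0].

Definition g_xi lam J p (u v : E) : R := dform lam p u (J p v).

(* J is defined on the whole of TM, with J X = 0. *)
Definition compatible_acs lam X J : Prop :=
  [/\ smooth_endomorphism J,
      forall p, J p (X p) = 0,
      forall p v, lam p v = 0 -> lam p (J p v) = 0 /\ J p (J p v) = - v,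
      forall p u v, lam p u = 0 -> lam p v = 0 ->
        g_xi lam J p u v = g_xi lam J p v u /\
        g_xi lam J p (J p u) (J p v) = g_xi lam J p u v &
      forall p v, lam p v = 0 -> v != 0 -> 0 < g_xi lam J p v v].

Definition contact_triad lam X J : Prop :=
  [/\ contact_form lam, reeb_field lam X & compatible_acs lam X J].

Definition pi_xi lam X p (v : E) : E := v - lam p v *: X p.

Definition triad_metric lam X J p (u v : E) : R :=
  g_xi lam J p (pi_xi lam X p u) (pi_xi lam X p v) + lam p u * lam p v.

(* Maps from the cylinder R x S^1, S^1 = R/Z, are maps from the (tau, t)-plane
   that are 1-periodic in t; a tangent vector (a, b) is a d/dtau + b d/dt. *)
Local Notation plane := (R^o * R^o)%type.
Implicit Types (w : plane -> M) (z v : plane).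

Definition d_tau : plane := (1, 0).
Definition d_t : plane := (0, 1).

Definition j_std v : plane := (- v.2, v.1).

Definition smooth_cylinder_map w : Prop :=
  smooth_map w /\ forall tau t, w (tau, t + 1) = w (tau, t).

Definition dpi lam X w z v : E := pi_xi lam X (w z) (dmap w z v).

Definition dbar_pi lam X J w z v : E :=
  2^-1 *: (dpi lam X w z v + J (w z) (dpi lam X w z (j_std v))).

(* the one-form w^* lam o j *)
Definition pullback_j lam w z v : R := pullback w lam z (j_std v).

Definition contact_instanton lam X J w : Prop :=
  [/\ smooth_cylinder_map w,
      forall z v, dbar_pi lam X J w z v = 0 &
      forall z u v, ext_d (pullback_j lam w) z u v = 0].

(* On xi the triad metric is g_xi. *)
Definition dpi_norm2 lam X J w z : R :=
  g_xi lam J (w z) (dpi lam X w z d_tau) (dpi lam X w z d_tau) +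
  g_xi lam J (w z) (dpi lam X w z d_t) (dpi lam X w z d_t).

Definition dw_norm2 lam X J w z : R :=
  triad_metric lam X J (w z) (dmap w z d_tau) (dmap w z d_tau) +
  triad_metric lam X J (w z) (dmap w z d_t) (dmap w z d_t).

(* ||dw||_{C^0} < oo, for the flat metric and the triad metric.  Without this
   bound a massless instanton is only of the form gamma \o f with f harmonic,
   e.g. f(tau, t) = cosh(2 pi tau) cos(2 pi t), for which T = Q = 0. *)
Definition bounded_gradient lam X J w : Prop :=
  exists C : R, forall z, dw_norm2 lam X J w z <= C.

(* pi-harmonic energy over A x S^1 *)
Definition pi_energy lam X J w (A : set R) : \bar R :=
  ((2^-1 : R)%:E * \int[(@lebesgue_measure R \x @lebesgue_measure R)%E]_(z in
     (A `*` `[0%R, 1%R[)) (dpi_norm2 lam X J w (z.1, z.2))%:E)%E.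

Definition massless lam X J w : Prop := pi_energy lam X J w setT = 0%E.

Definition contact_action lam X J w : R :=
  fine (pi_energy lam X J w `[0, +oo[) +
  Rintegral lebesgue_measure `[0%R, 1%R[
    (fun t : R => pullback w lam (0, t) d_t).

Definition contact_charge lam w : R :=
  Rintegral lebesgue_measure `[0%R, 1%R[
    (fun t : R => pullback_j lam w (0, t) d_t).

(* w(tau, t) = gamma(- Q tau + T t), gamma parameterizing the leaf L *)
Definition factors_through X w (Q T : R) (L : set M) (I : set R)
  (gamma : R -> M) : Prop :=
  [/\ leaf X L, leaf_parameterization X L I gamma &
    forall tau t : R, I (- Q * tau + T * t) /\
      w (tau, t) = gamma (- Q * tau + T * t)].

End ContactTriad.

(* Main.v *)
Require Import Defs.
From HB Require Import structures.
From mathcomp Require Import all_boot all_order all_algebra.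
From mathcomp Require Import all_classical all_reals all_analysis.
From mathcomp Require Import ring lra.
Import Order.TTheory GRing.Theory Num.Theory.
Import numFieldNormedType.Exports.
Set Implicit Arguments.
Unset Strict Implicit.
Unset Printing Implicit Defensive.
Local Open Scope classical_set_scope.
Local Open Scope ring_scope.

(* Since w is massless and smooth, the xi-part of dw vanishes, so dw = a X
   with a = w^*lambda.  Such an a is closed, because d(w^*lambda) = w^*(d lambda)
   vanishes on multiples of X, and it is co-closed by the instanton equation:
   its two components are bounded 1-periodic harmonic functions on the plane,
   hence constant by Bernstein's gradient estimate, and a = -Q dtau + T dt.
   For every v in the plane, s |-> w(s v) and s |-> gamma(s (-Q v_1 + T v_2)),
   gamma being the maximal integral curve of X through w(0), are then integral
   curves of the same multiple of X, and they coincide.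
   The example of a leaf that is not closed is the z-axis in R^(2n+1) with its
   standard contact form. *)

(** Comparing curves on the lines through 0 avoids choosing a primitive of the closed form and
    treats all pairs (Q, T) alike: where -Q v_1 + T v_2 = 0 both curves are integral curves of the
    zero field, and otherwise [w] along the rescaled line is an integral curve of X defined for all
    time, which forces the maximal interval to be R. The obstacle throughout is that tangent vectors
    at p are read in [chart_at p], a chart that may jump with p. Nothing built from [dmap] is
    visibly continuous, so each regularity statement is first rewritten in one fixed chart. The
    cylinder is unbounded only in tau, and periodicity supplies compactness in t. Hence the gradient
    estimate is made only for tau-derivatives, on strips whose width tends to infinity; the
    first-order system satisfied by the components of a handles the t-derivatives. Zero energy
    concerns a single period and an integral: continuity makes the integrand vanish pointwise there,
    and periodicity carries this to the plane. Since the circle has length 1, constant components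
    are their own integrals, and j d/dt = -d/dtau gives the sign of Q. *)

Section DirectionalDerivatives.
Context {R : realType}.
Implicit Types V W : normedModType R.

(** The map ['d f x] is also a first-order approximation of [g], and [diff_unique] identifies it
    with ['d g x]. *)
Lemma near_eq_differentiable V W (f g : V -> W) (x : V) :
  (\forall y \near x, f y = g y) -> differentiable f x -> differentiable g x.
Proof.
move=> fg df; have fgx := nbhs_singleton fg.
have H : g \o shift x = cst (g x) + 'd f x +o_ (0 : V) id.
  apply/eqaddoP => e e0.
  have /eqaddoP/(_ e e0) := diff_locally df.
  apply: filter_app.
  have : \forall y \near (0 : V), f (y + x) = g (y + x).
    by move: fg; rewrite (near_shift 0) subr0.
  apply: filter_app; near=> y => fgy.
  rewrite -![(_ + _ : _ -> _) _]/(_ + _) -![(- _ : _ -> _) _]/(- _) /=.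
  by rewrite /cst /= fgx fgy.
have cf := diff_continuous df.
have dE := diff_unique cf H.
by apply/diff_locallyP; rewrite dE.
Unshelve. all: by end_near. Qed.

Lemma is_derive_line V W (f : V -> W) (x u : V) (s : R) (df : W) :
  is_derive (x + s *: u) u f df ->
  is_derive (s : R^o) (1 : R^o) (fun s : R^o => f (x + s *: u) : W) df.
Proof.
have E : (fun h : R => h^-1 *: (((fun s : R^o => f (x + s *: u)) \o shift (s : R^o)) (h *: (1 : R^o)) - f (x + s *: u)))
       = (fun h : R => h^-1 *: ((f \o shift (x + s *: u)) (h *: u) - f (x + s *: u))).
  apply/funext => h /=; congr (_ *: (f _ - _)).
  by rewrite [_ *: 1]mulr1 scalerDl addrCA.
by case=> d1 d2; split; [rewrite /derivable E | rewrite /derive E].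
Qed.

Lemma derive_compE V V' W (f : V -> V') (g : V' -> W) (x v : V) :
  differentiable f x -> differentiable g (f x) ->
  'D_v (g \o f) x = 'D_('D_v f x) g (f x).
Proof.
move=> df dg; rewrite !deriveE//; first by rewrite diff_comp.
exact: differentiable_comp.
Qed.

Lemma derive_linDl V W (f : V -> W) (x u v : V) : differentiable f x ->
  'D_(u + v) f x = 'D_u f x + 'D_v f x.
Proof. by move=> df; rewrite !deriveE// linearD. Qed.

Lemma derive_linZl V W (f : V -> W) (x u : V) (k : R) : differentiable f x ->
  'D_(k *: u) f x = k *: 'D_u f x.
Proof. by move=> df; rewrite !deriveE// linearZ. Qed.

Lemma derive_rowE m W (f : 'rV[R]_m -> W) (x v : 'rV[R]_m) :
  differentiable f x ->
  'D_v f x = \sum_i v 0 i *: 'D_(delta_mx 0 i) f x.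
Proof.
move=> df; rewrite deriveE// {1}(row_sum_delta v) linear_sum.
by apply: eq_bigr => i _; rewrite linearZ deriveE.
Qed.

Lemma derive_coord V m (f : V -> 'rV[R]_m) (x v : V) i :
  derivable f x v -> 'D_v (fun y => f y 0 i : R^o) x = 'D_v f x 0 i.
Proof. by move=> df; rewrite derive_mx// mxE. Qed.

Lemma differentiable_row V m (f : V -> 'rV[R]_m) (x : V) :
  (forall i, differentiable (fun y => f y 0 i : R^o) x) -> differentiable f x.
Proof.
move=> df.
have -> : f = \sum_(i < m) (fun y => f y 0 i *: (delta_mx 0 i : 'rV[R]_m)).
  by apply/funext => y; rewrite fct_sumE -row_sum_delta.
apply: differentiable_sum => i.
exact: (@differentiableZl _ _ _ (fun y => f y 0 i)).
Qed.

Lemma differentiable_rowcoord V m (f : V -> 'rV[R]_m) (x : V) i :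
  differentiable f x -> differentiable (fun y => f y 0 i : R^o) x.
Proof.
move=> df; apply: (differentiable_comp (g := fun M : 'rV[R]_m => M 0 i : R^o)) => //.
exact: differentiable_coord.
Qed.

End DirectionalDerivatives.

(** * Closure properties of functions of class C^k *)

Section CkTheory.
Context {R : realType}.
Implicit Types V W : normedModType R.

Lemma near_open V (U : set V) (P : V -> Prop) (x : V) : open U -> U x ->
  (forall y, U y -> P y) -> \forall y \near x, P y.
Proof. by move=> oU Ux UP; apply: filterS UP _; exact: open_nbhs_nbhs. Qed.

(** [Ck] speaks of derivatives in the ambient space, so agreement on [U] is used through
    neighbourhoods of its points; this is where openness enters. *)
Lemma Ck_ext V W k (U : set V) (f g : V -> W) : open U ->
  (forall x, U x -> f x = g x) -> Ck k U f -> Ck k U g.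
Proof.
elim: k f g => [|k IH] f g oU fg /=.
  move=> cf x Ux; have fgx := fg x Ux.
  rewrite /prop_for /continuous_at -fgx.
  apply: cvg_trans (cf x Ux); apply: near_eq_cvg.
  by apply: (near_open oU) => // y /fg.
move=> [df Df]; split=> [x Ux|v].
  apply: near_eq_differentiable (df x Ux).
  exact: (near_open oU).
apply: IH (Df v) => // x Ux; apply: near_eq_derive.
exact: (near_open oU).
Qed.

Lemma Ck_sub V W k (U U' : set V) (f : V -> W) : U' `<=` U ->
  Ck k U f -> Ck k U' f.
Proof.
elim: k f => [|k IH] f sU /= => [cf x /sU /cf//|[df Df]].
by split=> [x /sU/df//|v]; exact: IH.
Qed.

Lemma CkS V W k (U : set V) (f : V -> W) : Ck k.+1 U f -> Ck k U f.
Proof.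
elim: k f => [|k IH] f [df Df].
  by move=> x /df; exact: differentiable_continuous.
by split=> // v; apply: IH; exact: Df.
Qed.

Lemma Ck_continuous V W k (U : set V) (f : V -> W) : Ck k U f ->
  forall x, U x -> {for x, continuous f}.
Proof. by elim: k => [//|k IH] /CkS. Qed.

Lemma Ck_cst V W k (U : set V) (a : W) : Ck k U (fun=> a).
Proof.
elim: k a => [|k IH] a /=; first by move=> x _; exact: cst_continuous.
split=> [x _|v]; first exact: differentiable_cst.
rewrite [X in Ck _ _ X](_ : _ = fun=> 0)//.
by apply/funext => x; exact: derive_cst.
Qed.

Lemma CkD V W k (U : set V) (f g : V -> W) : open U ->
  Ck k U f -> Ck k U g -> Ck k U (fun x => f x + g x).
Proof.
move=> oU; elim: k f g => [|k IH] f g /=.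
  by move=> cf cg x Ux; apply: (@continuousD _ _ _ f g); [exact: cf|exact: cg].
move=> [df Df] [dg Dg]; split=> [x Ux|v].
  by apply: (@differentiableD _ _ _ f g); [exact: df|exact: dg].
apply: Ck_ext (IH _ _ (Df v) (Dg v)) => // x Ux.
by rewrite (@deriveD _ _ _ f g)//; apply: diff_derivable; (exact: df || exact: dg).
Qed.

Lemma Ck_sum V W k (U : set V) (I : Type) (s : seq I) (F : I -> V -> W) :
  open U -> (forall i, Ck k U (F i)) -> Ck k U (fun x => \sum_(i <- s) F i x).
Proof.
move=> oU CF; elim: s => [|i s IH].
  by under eq_fun do rewrite big_nil; exact: Ck_cst.
by under eq_fun do rewrite big_cons; exact: CkD.
Qed.

Lemma CkM V k (U : set V) (f g : V -> R^o) : open U ->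
  Ck k U f -> Ck k U g -> Ck k U (fun x => f x * g x : R^o).
Proof.
move=> oU; elim: k f g => [|k IH] f g.
  by move=> /= cf cg x Ux; apply: (@continuousM _ _ f g); [exact: cf|exact: cg].
move=> Cf Cg; have [/= df Df] := Cf; have [/= dg Dg] := Cg.
split=> [x Ux|v].
  by apply: (@differentiableM _ _ f g); [exact: df|exact: dg].
apply: Ck_ext (CkD oU (IH _ _ (CkS Cf) (Dg v)) (IH _ _ (Df v) (CkS Cg))) => //.
move=> x Ux /=.
rewrite (@deriveM _ _ f g)//; first by congr (_ + _); rewrite mulrC.
all: by apply: diff_derivable; (exact: df || exact: dg).
Qed.

Lemma Ck_coord V m k (U : set V) (f : V -> 'rV[R]_m) i : open U ->
  Ck k U f -> Ck k U (fun x => f x 0 i : R^o).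
Proof.
move=> oU; elim: k f => [|k IH] f /=.
  move=> cf x Ux.
  apply: (@continuous_comp _ _ _ f (fun M : 'rV[R]_m => M 0 i : R^o)).
    exact: cf.
  exact: coord_continuous.
move=> [df Df]; split=> [x Ux|v].
  by apply: differentiable_rowcoord; exact: df.
apply: Ck_ext (IH _ (Df v)) => // x Ux.
by rewrite derive_coord//; apply: diff_derivable; exact: df.
Qed.

Lemma Ck_row V m k (U : set V) (f : V -> 'rV[R]_m) : open U ->
  (forall i, Ck k U (fun x => f x 0 i : R^o)) -> Ck k U f.
Proof.
move=> oU; elim: k f => [|k IH] f.
  move=> cf.
  have -> : f = fun y => \sum_(i < m) f y 0 i *: (delta_mx 0 i : 'rV[R]_m).
    by apply/funext => y; rewrite -row_sum_delta.
  apply: Ck_sum => // i x Ux; apply: cvgZr_tmp; exact: cf.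
move=> Cf.
have df x : U x -> differentiable f x.
  by move=> Ux; apply: differentiable_row => i; have [df _] := Cf i; exact: df.
split=> // v; apply: IH => i; have [_ Df] := Cf i.
apply: Ck_ext (Df v) => // x Ux.
by rewrite derive_coord//; apply: diff_derivable; exact: df.
Qed.

(** The direction ['D_v f x] varies with [x], while [Ck] controls [g] only in fixed directions.
    Expanding it over the basis rows turns the chain rule into a sum of products to which the
    induction hypothesis applies. *)
Lemma Ck_comp V m k (U : set V) (U' : set 'rV[R]_m) (f : V -> 'rV[R]_m)
    (g : 'rV[R]_m -> R^o) : open U -> open U' ->
  (forall x, U x -> U' (f x)) ->
  Ck k U f -> Ck k U' g -> Ck k U (g \o f).
Proof.
move=> oU oU' fU; elim: k f g fU => [|k IH] f g fU.
  move=> cf cg x Ux; apply: continuous_comp; first exact: cf.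
  by apply: cg; exact: fU.
move=> Cf Cg; have [/= df Df] := Cf; have [/= dg Dg] := Cg.
split=> [x Ux|v].
  by apply: differentiable_comp; [exact: df|apply: dg; exact: fU].
pose h x : R^o := \sum_(i < m)
  ('D_v f x) 0 i * ('D_(delta_mx 0 i) g \o f) x.
apply: (@Ck_ext _ _ _ _ h) => //.
  move=> x Ux; have dfx := df _ Ux; have dgx := dg _ (fU _ Ux).
  by rewrite derive_compE// derive_rowE.
apply: Ck_sum => // i; apply: CkM => //.
  by apply: (@Ck_coord _ _ _ _ ('D_v f)) => //; exact: Df.
by apply: IH => //; [exact: CkS|exact: Dg].
Qed.

Lemma Ck_line V W k (U : set V) (f : V -> W) (u : V) : open U ->
  Ck k U f ->
  Ck k ((fun s : R^o => s *: u) @^-1` U) (fun s : R^o => f (s *: u)).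
Proof.
move=> oU; elim: k f => [|k IH] f.
  move=> cf s Us; apply: (@continuous_comp _ _ _ (fun s : R^o => s *: u) f).
    exact: scalel_continuous.
  exact: cf.
move=> [df Df].
have dl (s : R^o) : differentiable (fun s : R^o => s *: u) s.
  by apply: (@differentiableZl _ _ _ id).
split=> [s Us|v].
  by apply: (@differentiable_comp _ _ _ _ (fun s : R^o => s *: u)) => //; exact: df.
apply: Ck_ext (IH _ (Df (v *: u))).
  apply: open_comp => // s _; exact: scalel_continuous.
move=> s Us /=.
rewrite (@derive_compE _ _ _ _ (fun s : R^o => s *: u) f) //; last exact: df.
congr ('D__ f _); rewrite deriveE//.
by rewrite (@diffZl _ _ _ id)// diff_val.
Qed.

End CkTheory.

(** * Mean value theorem: symmetry of second derivatives, Lipschitz bounds *)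

Section MeanValue.
Context {R : realType}.
Implicit Types V W : normedModType R.

Lemma MVT_closed (f df : R -> R) (a b : R) : a <= b ->
  (forall s : R, a <= s <= b -> is_derive (s : R^o) (1 : R^o) (f : R^o -> R^o) (df s)) ->
  exists2 c, a <= c <= b & f b - f a = (b - a) * df c.
Proof.
move=> ab fdf.
have [| |c] := @MVT_segment R f df a b ab.
- by move=> x; rewrite in_itv /= => /andP[/ltW ax /ltW xb]; apply: fdf; rewrite ax.
- apply: derivable_within_continuous => x; rewrite in_itv /= => xab.
  by have [] := fdf _ xab.
- by rewrite in_itv /= => cab E; exists c; rewrite // mulrC.
Qed.

Lemma second_difference V (f : V -> R^o) (x u v : V) (h : R) : 0 <= h ->
  (forall s t : R, 0 <= s <= h -> 0 <= t <= h ->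
    derivable f (x + s *: u + t *: v) u /\
    derivable ('D_u f) (x + s *: u + t *: v) v) ->
  exists s t : R, [/\ 0 <= s <= h, 0 <= t <= h &
    f (x + h *: u + h *: v) - f (x + h *: u) - (f (x + h *: v) - f x) =
    h * (h * 'D_v ('D_u f) (x + s *: u + t *: v))].
Proof.
move=> h0 df.
have hh : 0 <= h <= h by rewrite h0 lexx.
have h00 : 0 <= (0 : R) <= h by rewrite h0 lexx.
have lineu (t s : R) : 0 <= t <= h -> 0 <= s <= h ->
    is_derive (s : R^o) (1 : R^o) (fun s : R^o => f (x + s *: u + t *: v) : R^o)
      ('D_u f (x + s *: u + t *: v)).
  move=> th sh; have [d1 _] := df _ _ sh th.
  rewrite (_ : (fun _ => _) = (fun s => f ((x + t *: v) + s *: u))); last first.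
    by apply/funext => r; rewrite addrAC.
  by apply: is_derive_line; rewrite addrAC; exact: derivableP.
have [s sh E] : exists2 s : R, 0 <= s <= h &
    f (x + h *: u + h *: v) - f (x + h *: u) - (f (x + h *: v) - f x) =
    h * ('D_u f (x + s *: u + h *: v) - 'D_u f (x + s *: u)).
  pose F s := f (x + s *: u + h *: v) - f (x + s *: u).
  have [s sh|s sh E] := @MVT_closed F
    (fun s => 'D_u f (x + s *: u + h *: v) - 'D_u f (x + s *: u)) _ _ h0.
    apply: is_deriveB; first exact: lineu.
    by have := lineu 0 s h00 sh; under eq_fun do rewrite scale0r addr0;
      rewrite scale0r addr0.
  exists s => //; move: E; rewrite /F scale0r addr0 subr0 => <-.
  by ring.
have [t th|t th Et] := @MVT_closed (fun t => 'D_u f (x + s *: u + t *: v))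
    (fun t => 'D_v ('D_u f) (x + s *: u + t *: v)) _ _ h0.
  apply: (@is_derive_line _ _ _ ('D_u f)); apply: derivableP.
  by have [] := df _ _ sh th.
exists s, t; split => //; rewrite E; congr (_ * _).
by move: Et; rewrite scale0r addr0 subr0.
Qed.

(** Tailored to [derive_swap], where the two mixed derivatives are only known to agree at two
    different points near [x]. *)
Lemma continuous_eq_approx V (f g : V -> R^o) (x : V) :
  {for x, continuous f} -> {for x, continuous g} ->
  (forall r : R, 0 < r -> exists y z, [/\ ball x r y, ball x r z & f y = g z]) ->
  f x = g x.
Proof.
move=> cf cg fg; apply/eqP; rewrite -subr_eq0 -normr_le0.
apply/ler_addgt0Pr => e e0; rewrite add0r.
have e2 : 0 < e / 2 by rewrite divr_gt0.
move/cvgrPdist_lt : cf => /(_ _ e2)/nbhs_ballP[r /= r0 rP].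
move/cvgrPdist_lt : cg => /(_ _ e2)/nbhs_ballP[r' /= r'0 r'P].
have m0 : 0 < Num.min r r' by rewrite lt_min r0.
have [y [z [xy xz E]]] := fg _ m0.
have {}xy : ball x r y by apply: le_ball xy; rewrite ge_min lexx.
have {}xz : ball x r' z by apply: le_ball xz; rewrite ge_min lexx orbT.
rewrite -(subrKA (f y)) (splitr e) (le_trans (ler_normD _ _))//.
by rewrite lerD ?(ltW (rP _ xy))// E distrC ltW// r'P.
Qed.

Lemma derive_swap V (U : set V) (f : V -> R^o) (x u v : V) : open U ->
  Ck 2 U f -> U x -> 'D_u ('D_v f) x = 'D_v ('D_u f) x.
Proof.
move=> oU [df Df] Ux.
have c1 : {for x, continuous ('D_u ('D_v f))}.
  by apply: (Ck_continuous (k := 0)) Ux; have [] := Df v; move=> _; apply.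
have c2 : {for x, continuous ('D_v ('D_u f))}.
  by apply: (Ck_continuous (k := 0)) Ux; have [] := Df u; move=> _; apply.
apply: (@continuous_eq_approx _ ('D_u ('D_v f)) ('D_v ('D_u f)) x c1 c2) => r' r'0.
have /nbhs_ballP[r'' /= r''0 r''U] : nbhs x U by exact: open_nbhs_nbhs.
pose r := Num.min r' r''.
have r0 : 0 < r by rewrite lt_min r'0.
have rU y : ball x r y -> U y.
  by move=> xy; apply: r''U; apply: le_ball xy; rewrite ge_min lexx orbT.
have rr' y : ball x r y -> ball x r' y.
  by move=> xy; apply: le_ball xy; rewrite ge_min lexx.
(* The parallelogram spanned at [x] by [h *: u] and [h *: v] then lies in the ball of radius [r];
   the summand 1 keeps the quotient meaningful when [u] and [v] vanish. *)
pose h := r / (`|u| + `|v| + 1).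
have n0 : 0 < `|u| + `|v| + 1 by rewrite ltr_wpDl// addr_ge0.
have h0 : 0 < h by rewrite divr_gt0.
have inball (a b : V) (s t : R) : `|a| + `|b| = `|u| + `|v| ->
    0 <= s <= h -> 0 <= t <= h ->
    ball x r (x + s *: a + t *: b).
  move=> ab /andP[s0 sh] /andP[t0 th].
  rewrite -ball_normE /ball_ /= -addrA opprD addNKr normrN.
  apply: (@le_lt_trans _ _ (h * (`|u| + `|v|))).
    rewrite (le_trans (ler_normD _ _))// !normrZ (ger0_norm s0) (ger0_norm t0).
    by rewrite -ab mulrDr lerD// ler_wpM2r.
  rewrite [ltRHS](_ : r = h * (`|u| + `|v| + 1)) ?ltr_pM2l ?ltrDl//.
  by rewrite mulfVK// gt_eqF.
have dDf w y : U y -> differentiable ('D_w f) y.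
  by move=> Uy; have [] := Df w; move=> + _; apply.
have [|s [t [sh th E1]]] := @second_difference V f x u v h (ltW h0).
  move=> s t sh th.
  have Uy := rU _ (inball u v _ _ erefl sh th).
  by split; apply: diff_derivable; [exact: df|exact: dDf].
have [|s' [t' [sh' th' E2]]] := @second_difference V f x v u h (ltW h0).
  move=> s' t' sh' th'.
  have Uy := rU _ (inball v u _ _ (addrC _ _) sh' th').
  by split; apply: diff_derivable; [exact: df|exact: dDf].
exists (x + s' *: v + t' *: u), (x + s *: u + t *: v); split.
- by apply: rr'; apply: inball => //; rewrite addrC.
- by apply: rr'; exact: inball.
have hn0 : h != 0 by rewrite gt_eqF.
have inj (a b : R) : h * (h * a) = h * (h * b) -> b = a.
  by move=> /(mulfI hn0)/(mulfI hn0).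
have alg (a b c d : R) : a - b - (c - d) = a - c - (b - d) by ring.
have E : f (x + h *: u + h *: v) - f (x + h *: u) - (f (x + h *: v) - f x) =
         f (x + h *: v + h *: u) - f (x + h *: v) - (f (x + h *: u) - f x).
  by rewrite (addrAC x (h *: v)) alg.
exact: inj (etrans (esym E1) (etrans E E2)).
Qed.

Lemma row_norm_le m (v : 'rV[R]_m) (K : R) : 0 <= K ->
  (`|v| <= K) <-> (forall i, `|v 0 i| <= K).
Proof.
move=> K0; split=> [vK i|vK].
  apply: le_trans vK; rewrite [leRHS]/Num.Def.normr/= mx_normrE.
  exact: (le_bigmax _ _ (ord0, i)).
rewrite [leLHS]/Num.Def.normr/= mx_normrE; apply: bigmax_le => // -[i j] _ /=.
by rewrite (ord1 i).
Qed.

(** The norm of a row is the maximum of its coordinates, so the mean value theorem can be used for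
    each coordinate, with its own intermediate point, at no loss in the constant. *)
Lemma mean_value_bound m (y dy : R -> 'rV[R]_m) (a b K : R) : 0 <= K ->
  (forall s : R, Num.min a b <= s <= Num.max a b ->
    is_derive (s : R^o) (1 : R^o) (y : R^o -> _) (dy s) /\ `|dy s| <= K) ->
  `|y b - y a| <= K * `|b - a|.
Proof.
wlog ab : a b / a <= b.
  move=> H K0 yP; have [ab|/ltW ba] := leP a b; first exact: H.
  by rewrite distrC (distrC b); apply: H => // s; rewrite minC maxC; exact: yP.
rewrite (min_l ab) (max_r ab) => K0 yP.
apply/row_norm_le => [|i]; first by rewrite mulr_ge0.
rewrite !mxE.
have [s sab|c cab ->] := @MVT_closed (fun s => y s 0 i) (fun s => dy s 0 i) _ _ ab.
  have [[d1 d2] _] := yP _ sab.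
  apply: DeriveDef; first by have /derivable_mxP := d1; apply.
  by rewrite derive_coord// d2.
rewrite normrM mulrC ler_wpM2r//.
by have [_ /row_norm_le] := yP _ cab; apply.
Qed.

(** By continuity each partial derivative exceeds its size at [x0] by at most 1 on a small ball.
    Balls are convex, so [mean_value_bound] applies along the segment from [y] to [x]. *)
Lemma C1_locally_lipschitz m (U : set 'rV[R]_m) (f : 'rV[R]_m -> 'rV[R]_m) x0 :
  open U -> Ck 1 U f -> U x0 ->
  exists K r, [/\ 0 <= K, 0 < r, ball x0 r `<=` U & 
    forall x y, ball x0 r x -> ball x0 r y -> `|f x - f y| <= K * `|x - y|].
Proof.
move=> oU [df Df] Ux0.
pose B := \sum_(i < m) (`|'D_(delta_mx 0 i) f x0| + 1).
have /nbhs_ballP[r /= r0 rP] : \forall y \near x0, U y /\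
    forall i : 'I_m, `|'D_(delta_mx 0 i) f y| <= `|'D_(delta_mx 0 i) f x0| + 1.
  near=> y; split; first by near: y; exact: open_nbhs_nbhs.
  near: y; apply: filter_forall => i.
  have /cvgrPdist_lt/(_ 1 ltr01) := Df (delta_mx 0 i) x0 Ux0.
  apply: filterS => z; move: ('D__ f z) ('D__ f x0) => a b /ltW; rewrite distrC => ab.
  by rewrite -lerBlDl (le_trans (lerB_dist _ _)).
have B0 : 0 <= B by apply: sumr_ge0 => i _; rewrite addr_ge0.
exists B, r; split => // [y /rP[]//|x y bx by_].
have -> : f x - f y = f (y + 1 *: (x - y)) - f (y + 0 *: (x - y)).
  by rewrite scale1r scale0r addr0 addrCA subrr addr0.
have K0 : 0 <= B * `|x - y| by rewrite mulr_ge0.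
have := @mean_value_bound m (fun s => f (y + s *: (x - y)))
  (fun s => 'D_(x - y) f (y + s *: (x - y))) 0 1 _ K0.
rewrite subr0 normr1 mulr1; apply => s.
rewrite (min_l ler01) (max_r ler01) => /andP[s0 s1].
have [Us Ds] : U (y + s *: (x - y)) /\ forall i : 'I_m,
    `|'D_(delta_mx 0 i) f (y + s *: (x - y))| <= `|'D_(delta_mx 0 i) f x0| + 1.
  apply: rP; move: bx by_; rewrite -ball_normE /ball_ /= => bx by_.
  have -> : x0 - (y + s *: (x - y)) = (1 - s) *: (x0 - y) + s *: (x0 - x).
    by rewrite scalerBl scale1r !scalerBr; apply/rowP => i; rewrite !mxE; ring.
  rewrite (le_lt_trans (ler_normD _ _))// !normrZ (ger0_norm s0).
  rewrite ger0_norm ?subr_ge0//.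
  (* Strictness comes from the summand with factor [s], hence the separate case [s = 0]. *)
  have [->|s_neq0] := eqVneq s 0; first by rewrite subr0 mul1r mul0r addr0.
  rewrite [ltRHS](_ : r = (1 - s) * r + s * r); last by ring.
  apply: ler_ltD; first by rewrite ler_wpM2l ?subr_ge0// ltW.
  by rewrite ltr_pM2l// lt_neqAle eq_sym s_neq0.
split; first by apply: is_derive_line; apply: derivableP; apply: diff_derivable; exact: df.
rewrite derive_rowE; last exact: df.
rewrite (le_trans (ler_norm_sum _ _ _))// /B mulr_suml ler_sum// => i _.
rewrite normrZ mulrC ler_pM//.
exact: (row_norm_le _ (normr_ge0 _)).1.
Unshelve. all: by end_near. Qed.

End MeanValue.

(** * A maximum principle and Bernstein's gradient estimate *)

Section Bernstein.
Context {R : realType}.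

(* A definition rather than a notation, lest the class [is_derive] triggers
   instance search when the lemmas below are applied. *)
Definition deriv (f : R -> R) (s d : R) : Prop :=
  is_derive (s : R^o) (1 : R^o) (f : R^o -> R^o) (d : R^o).

Lemma deriv_mul (f g : R -> R) (s df dg : R) :
  deriv f s df -> deriv g s dg ->
  deriv (fun x => f x * g x) s (f s * dg + g s * df).
Proof. by move=> Df Dg; exact: is_deriveM. Qed.

Lemma deriv_add (f g : R -> R) (s df dg : R) :
  deriv f s df -> deriv g s dg -> deriv (fun x => f x + g x) s (df + dg).
Proof. by move=> Df Dg; exact: is_deriveD. Qed.

Lemma deriv_cst (a s : R) : deriv (fun=> a) s 0.
Proof. exact: is_derive_cst. Qed.

Lemma deriv_id (s : R) : deriv (fun x => x) s 1.
Proof. exact: is_derive_id. Qed.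

Lemma deriv_eq (f g : R -> R) (s d d' : R) :
  f =1 g -> d = d' -> deriv f s d -> deriv g s d'.
Proof. by move=> /funext -> ->. Qed.

(** If [f2] were positive, [f1], which vanishes at [c], would be positive just to the right of [c],
    and [f] would increase there. *)
Lemma second_derivative_at_max (f f1 : R -> R) (c f2 r : R) : 0 < r ->
  (forall s, deriv f s (f1 s)) -> deriv f1 c f2 ->
  (forall s, `|s - c| < r -> f s <= f c) -> f2 <= 0.
Proof.
move=> r0 df df1 fmax; rewrite leNgt; apply/negP => f20.
have inr s : (s \in `]c - r, c + r[) = (`|s - c| < r).
  by rewrite in_itv /= ltr_distl.
have f1c0 : f1 c = 0.
  have cin : c \in `]c - r, c + r[ by rewrite inr subrr normr0.
  have rr : c - r <= c + r by rewrite lerD2l ge0_cp// ltW.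
  have dfr (t : R) : t \in `]c - r, c + r[ -> derivable (f : R^o -> R^o) t 1.
    by move=> _; have [] := df t.
  have [t|_ <-] := @derive1_at_max R f _ _ c rr dfr cin.
    by rewrite inr; exact: fmax.
  by have [_ ->] := df c.
have [d1 d2] := df1.
have : (fun h : R => h^-1 *: ((f1 \o shift (c : R^o)) (h *: (1 : R^o)) - f1 c)) @ 0^' --> f2.
  by rewrite -d2; exact: d1.
move=> /cvgrPdist_lt/(_ _ f20); rewrite near_withinE /= => /nbhs_ballP[e /= e0 eP].
have f1pos h : 0 < h -> h < e -> 0 < f1 (h + c).
  move=> h0 he; have : `|f2 - h^-1 * (f1 (h + c) - f1 c)| < f2.
    have := eP h; rewrite /ball /= sub0r normrN gtr0_norm// => /(_ he).
    rewrite gt_eqF// => /(_ isT); rewrite /shift /=.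
    by rewrite [_ *: 1]mulr1.
  rewrite f1c0 subr0 ltr_distl => /andP[_]; rewrite ltrDr.
  by rewrite pmulr_rgt0// invr_gt0.
pose h := Num.min e r / 2.
have m0 : 0 < Num.min e r by rewrite lt_min e0.
have h0 : 0 < h by rewrite divr_gt0.
have hm : h < Num.min e r by rewrite ltr_pdivrMr// ltr_pMr// ltr1n.
have ch : c < c + h by rewrite ltrDl.
have [|d] := @MVT R f f1 c (c + h) ch (fun x _ => df x).
  by apply: derivable_within_continuous => x _; have [] := df x.
rewrite in_itv /= => /andP[cd dh] E.
have : f (c + h) <= f c.
  apply: fmax; rewrite addrAC subrr add0r gtr0_norm// (lt_le_trans hm)//.
  by rewrite ge_min lexx orbT.
rewrite -subr_le0 E leNgt => /negP; apply; rewrite mulr_gt0 ?subr_gt0//.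
rewrite -(subrK c d) f1pos ?subr_gt0// ltrBlDl (lt_trans dh)// ltrD2l.
by rewrite (lt_le_trans hm)// ge_min lexx.
Qed.

(* Bernstein's method: on the strip |tau - tau0| <= r the function
   (r^2 - (tau - tau0)^2)^2 v^2 + 12 r^2 u^2 + (tau - tau0)^2, where v = u_tau,
   is strictly subharmonic, so its maximum lies where the first summand vanishes. *)
Lemma bernstein_estimate (u v : R^o * R^o -> R)
    (ut utt v1 v11 vt vtt : R -> R -> R) (B r a0 b0 : R) : 0 < r ->
  continuous (u : _ -> R^o) -> continuous (v : _ -> R^o) ->
  (forall a b, u (a, b + 1) = u (a, b)) ->
  (forall a b, v (a, b + 1) = v (a, b)) ->
  (forall z, `|u z| <= B) ->
  (forall a b, deriv (fun s => u (s, b)) a (v (a, b))) ->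
  (forall a b, deriv (fun s => v (s, b)) a (v1 a b)) ->
  (forall a b, deriv (fun s => v1 s b) a (v11 a b)) ->
  (forall a b, deriv (fun s => u (a, s)) b (ut a b)) ->
  (forall a b, deriv (fun s => ut a s) b (utt a b)) ->
  (forall a b, deriv (fun s => v (a, s)) b (vt a b)) ->
  (forall a b, deriv (fun s => vt a s) b (vtt a b)) ->
  (forall a b, v1 a b + utt a b = 0) ->
  (forall a b, v11 a b + vtt a b = 0) ->
  r ^+ 4 * v (a0, b0) ^+ 2 <= 12 * r ^+ 2 * B ^+ 2 + r ^+ 2.
Proof.
move=> r0 cu cv pu pv uB du dv dv1 dut dutt dvt dvtt hu hv.
pose phi (z : R^o * R^o) : R^o := let x := z.1 - a0 in
  (r ^+ 2 - x ^+ 2) ^+ 2 * v z ^+ 2 + 12 * r ^+ 2 * u z ^+ 2 + x ^+ 2.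
(* One closed period in t makes the strip compact; by periodicity a maximum over [K] is a maximum
   over the whole strip. *)
pose K : set (R^o * R^o) := `[a0 - r, a0 + r] `*` `[b0, b0 + 1].
have cK : compact K by apply: compact_setX; exact: segment_compact.
have Kab : K (a0, b0).
  split; rewrite /= in_itv /=; last by rewrite lexx lerDl ler01.
  by rewrite lerBlDr !lerDl !ltW.
have cphi : continuous phi.
  have cx : continuous (fun z : R^o * R^o => z.1 - a0 : R^o).
    by move=> z; apply: cvgB; [exact: cvg_fst|exact: cvg_cst].
  have sq (g : R^o * R^o -> R^o) : continuous g -> continuous (fun z => g z ^+ 2 : R^o).
    by move=> cg z; apply: cvgM; exact: cg.
  move=> z; apply: cvgD; last exact: sq.
  apply: cvgD; apply: cvgM.
  - apply: (sq (fun z : R^o * R^o => r ^+ 2 - (z.1 - a0) ^+ 2)) => z'.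
    by apply: cvgB; [exact: cvg_cst|exact: sq].
  - exact: sq.
  - exact: cvg_cst.
  - exact: sq.
have [|[a b]] := @compact_EVT_max _ R phi K (ex_intro _ _ Kab) cK.
  by apply: continuous_subspaceT; exact: cphi.
rewrite inE => -[/= aK bK] zmax.
have {}zmax z : K z -> phi z <= phi (a, b) by move=> Kz; apply: zmax; rewrite inE.
have le0 : r ^+ 4 * v (a0, b0) ^+ 2 <= phi (a, b).
  apply: le_trans (zmax _ Kab); rewrite /phi /= subrr expr0n/= subr0 addr0.
  have -> : r ^+ 4 = (r ^+ 2) ^+ 2 by rewrite -exprM.
  by rewrite lerDl mulr_ge0 ?sqr_ge0// mulr_ge0 ?sqr_ge0.
apply: (le_trans le0).
have uB2 : u (a, b) ^+ 2 <= B ^+ 2.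
  by rewrite -[leLHS]real_normK ?num_real// ler_pXn2r ?nnegrE// ?(le_trans _ (uB (a, b))).
move: aK; rewrite in_itv /= => /andP[ra ar].
have xr : (a - a0) ^+ 2 <= r ^+ 2.
  rewrite -[leLHS]real_normK ?num_real// ler_pXn2r ?nnegrE//; last exact: ltW.
  by rewrite ler_norml lerBrDl ra/= lerBlDl.
(* On the boundary of the strip the first summand of [phi] vanishes and the other two give the
   bound. An interior maximum is excluded below. *)
have [E|] := eqVneq ((a - a0) ^+ 2) (r ^+ 2).
  rewrite /phi /= E subrr expr0n/= mul0r add0r lerD2r ler_wpM2l//.
  by rewrite mulr_ge0 ?sqr_ge0.
move=> neq; exfalso.
have xr' : (a - a0) ^+ 2 < r ^+ 2 by rewrite lt_neqAle neq.
have {xr'} : `|a - a0| < r.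
  by rewrite -(ltr_pXn2r (n := 2)) ?nnegrE// ?(ltW r0)// real_normK ?num_real.
rewrite ltr_norml => /andP[ra' ar'].
(* The functions to be differentiated are written with sums and products only, so that [deriv_add]
   and [deriv_mul] assemble the derivatives and [ring] compares them with the expected ones. *)
pose x s := s + - a0.
pose w s := r ^+ 2 + (-1) * (x s * x s).
have dx s : deriv x s (1 + 0) by exact: deriv_add (deriv_id s) (deriv_cst _ _).
have dw s : deriv w s (- 2 * x s).
  rewrite /w; apply: (deriv_eq (fun=> erefl)); last first.
  - repeat first [exact: dx | exact: deriv_cst | apply: deriv_add | apply: deriv_mul].
  - by cbv beta; ring.
pose c := 12 * r ^+ 2.
pose fa s := phi (s, b).
pose fa1 s := 2 * ((w s * w s) * (v (s, b) * v1 s b)) +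
  (- 4) * ((x s * w s) * (v (s, b) * v (s, b))) +
  (2 * c * (u (s, b) * v (s, b)) + 2 * x s).
pose fa2 := 2 * (w a * w a) * (v1 a b * v1 a b + v (a, b) * v11 a b)
  - 16 * (x a * w a) * (v (a, b) * v1 a b)
  + (8 * (x a * x a) - 4 * w a) * (v (a, b) * v (a, b))
  + 2 * c * (v (a, b) * v (a, b) + u (a, b) * v1 a b) + 2.
have dfa s : deriv fa s (fa1 s).
  apply: (@deriv_eq (fun s => (w s * w s) * (v (s, b) * v (s, b)) +
    (c * (u (s, b) * u (s, b)) + x s * x s))); last first.
  - repeat first [exact: dx | exact: dw | exact: dv | exact: du |
      exact: deriv_cst | apply: deriv_add | apply: deriv_mul].
  - by cbv beta; rewrite /fa1 /c; ring.
  - by move=> t; rewrite /fa /phi /w /x /c /=; ring.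
have dfa1 : deriv fa1 a fa2.
  rewrite /fa1; apply: (deriv_eq (fun=> erefl)); last first.
  - repeat first [exact: dx | exact: dw | exact: dv1 | exact: dv | exact: du |
      exact: deriv_cst | apply: deriv_add | apply: deriv_mul].
  - by cbv beta; rewrite /fa2 /c; ring.
pose fb s := phi (a, s).
pose fb1 s := (w a * w a) * 2 * (v (a, s) * vt a s) + 2 * c * (u (a, s) * ut a s).
pose fb2 := (w a * w a) * 2 * (vt a b * vt a b + v (a, b) * vtt a b)
  + 2 * c * (ut a b * ut a b + u (a, b) * utt a b).
have dfb s : deriv fb s (fb1 s).
  apply: (@deriv_eq (fun s => (w a * w a) * (v (a, s) * v (a, s)) +
    (c * (u (a, s) * u (a, s)) + x a * x a))); last first.
  - repeat first [exact: dvt | exact: dut |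
      exact: deriv_cst | apply: deriv_add | apply: deriv_mul].
  - by cbv beta; rewrite /fb1 /c; ring.
  - by move=> t; rewrite /fb /phi /w /x /c /=; ring.
have dfb1 : deriv fb1 b fb2.
  rewrite /fb1; apply: (deriv_eq (fun=> erefl)); last first.
  - repeat first [exact: dvtt | exact: dutt | exact: dvt | exact: dut |
      exact: deriv_cst | apply: deriv_add | apply: deriv_mul].
  - by cbv beta; rewrite /fb2 /c; ring.
have fa20 : fa2 <= 0.
  have m0 : 0 < Num.min (a - (a0 - r)) (a0 + r - a).
    by rewrite lt_min; apply/andP; split; lra.
  apply: (second_derivative_at_max m0 dfa dfa1) => s.
  rewrite lt_min !ltr_norml => /andP[/andP[s1 s2] /andP[s3 s4]].
  apply: zmax; split => //=; rewrite in_itv /=; apply/andP; split; lra.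
have fb20 : fb2 <= 0.
  (* In t the maximum may sit at an end of the period. A point at distance less than 1 from [b]
     returns to the period by at most one unit shift, which leaves [phi] unchanged. *)
  apply: (second_derivative_at_max ltr01 dfb dfb1) => s.
  rewrite ltr_norml => /andP[s1 s2].
  have aK : a \in `[a0 - r, a0 + r] by rewrite in_itv /=; apply/andP; split; lra.
  have phiD t : phi (a, t + 1) = phi (a, t) by rewrite /phi pu pv.
  move: bK; rewrite in_itv /= => /andP[b1 b2].
  have [sb|sb] := ltP s b0.
    rewrite /fb -phiD; apply: zmax; split => //=; rewrite in_itv /=.
    by apply/andP; split; lra.
  have [sb'|sb'] := ltP (b0 + 1) s.
    rewrite /fb -[s](subrK 1) phiD; apply: zmax; split => //=; rewrite in_itv /=.
    by apply/andP; split; lra.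
  by apply: zmax; split => //=; rewrite in_itv /=; apply/andP; split; lra.
have : 0 < fa2 + fb2; last by rewrite ltNge -oppr_ge0 opprD addr_ge0 ?oppr_ge0.
have xa : x a * x a < r ^+ 2 by rewrite -expr2 lt_neqAle neq.
(* With x = tau - a0 and w = r^2 - x^2, completing the square in the cross term -16 x w v v_tau
   costs 32 x^2 v^2. What is left is (8 x^2 - 4 w - 32 x^2 + 2 c) v^2, and c = 12 r^2 makes this 20
   (r^2 - x^2) v^2. The final 2 is the second derivative of x^2 and gives strict positivity. *)
have -> : fa2 + fb2 =
    2 * (w a * v1 a b - 4 * (x a * v (a, b))) ^+ 2 + 2 * (w a * vt a b) ^+ 2
    + 2 * c * (ut a b) ^+ 2 + 20 * (r ^+ 2 - x a * x a) * v (a, b) ^+ 2 + 2.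
  have hu' : utt a b = - v1 a b by have := hu a b; lra.
  have hv' : vtt a b = - v11 a b by have := hv a b; lra.
  by rewrite /fa2 /fb2 hu' hv' /c /w; ring.
have c0 : 0 <= c by rewrite mulr_ge0 ?sqr_ge0.
rewrite ltr_wpDl//.
rewrite !addr_ge0// mulr_ge0 ?sqr_ge0// ?mulr_ge0// ?subr_ge0; exact: ltW.
Qed.

End Bernstein.

(** * Bounded periodic solutions of the Cauchy-Riemann equations are constant *)

Section Liouville.
Context {R : realType}.
Local Notation plane := (R^o * R^o)%type.
Local Notation dtau := (@d_tau R).
Local Notation dt := (@d_t R).

Lemma smooth_derive (V W : normedModType R) (U : set V) (f : V -> W) v :
  smooth_on U f -> smooth_on U ('D_v f).
Proof. by move=> sf k; have [_] := sf k.+1; apply. Qed.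

Lemma smooth_differentiable (V W : normedModType R) (U : set V) (f : V -> W) x :
  smooth_on U f -> U x -> differentiable f x.
Proof. by move=> sf; have [+ _] := sf 1%N; apply. Qed.

Lemma smooth_is_derive (V W : normedModType R) (f : V -> W) x v :
  smooth_on setT f -> is_derive x v f ('D_v f x).
Proof.
by move=> sf; apply/derivableP/diff_derivable/(smooth_differentiable sf).
Qed.

Lemma smooth_swap (V : normedModType R) (f : V -> R^o) u v :
  smooth_on setT f -> 'D_u ('D_v f) = 'D_v ('D_u f).
Proof.
move=> sf; apply/funext => x.
exact: (@derive_swap R V setT f x u v openT (sf 2%N)).
Qed.

Lemma deriv_tau (f : plane -> R^o) (a b : R) : smooth_on setT f ->
  deriv (fun s => f (s, b)) a ('D_dtau f (a, b)).
Proof.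
move=> sf.
have E s : (s, b) = (0, b) + s *: dtau :> plane.
  by congr pair; rewrite /= ?add0r ?[_ *: _]mulr1// [_ *: _]mulr0 addr0.
rewrite /deriv (_ : (fun _ => _) = (fun s : R^o => f ((0, b) + s *: dtau))).
  by rewrite (E a); apply: is_derive_line; exact: smooth_is_derive.
by apply/funext => s; rewrite -E.
Qed.

Lemma deriv_t (f : plane -> R^o) (a b : R) : smooth_on setT f ->
  deriv (fun s => f (a, s)) b ('D_dt f (a, b)).
Proof.
move=> sf.
have E s : (a, s) = (a, 0) + s *: dt :> plane.
  by congr pair; rewrite /= ?add0r ?[_ *: _]mulr1// [_ *: _]mulr0 addr0.
rewrite /deriv (_ : (fun _ => _) = (fun s : R^o => f ((a, 0) + s *: dt))).
  by rewrite (E b); apply: is_derive_line; exact: smooth_is_derive.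
by apply/funext => s; rewrite -E.
Qed.

Lemma derive_periodic (V W : normedModType R) (f : V -> W) (e v : V) :
  (forall z, f (z + e) = f z) -> forall z, 'D_v f (z + e) = 'D_v f z.
Proof.
move=> fe z; rewrite /derive.
rewrite (_ : (fun h : R => _) =
  (fun h => h^-1 *: ((f \o shift z) (h *: v) - f z)))//.
by apply/funext => h /=; rewrite addrA !fe.
Qed.

(** Divided by r^4, the Bernstein bound reads v^2 <= (12 B^2 + 1) / r^2, and r is arbitrary. *)
Lemma bounded_harmonic_derive_tau (u : plane -> R^o) (B : R) :
  smooth_on setT u -> (forall z, u (z + dt) = u z) -> (forall z, `|u z : R| <= B) ->
  (forall z, 'D_dtau ('D_dtau u) z + 'D_dt ('D_dt u) z = 0) ->
  forall z, 'D_dtau u z = 0.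
Proof.
move=> su pu uB hu [a0 b0].
pose v := 'D_dtau u.
have sv : smooth_on setT v := smooth_derive dtau su.
have pv := derive_periodic dtau pu.
have sum0 (x y : R) : x + y = 0 -> y = - x.
  by move/eqP; rewrite addrC addr_eq0 => /eqP.
have sum0' (x y : R) : y = - x -> x + y = 0 by move=> ->; rewrite subrr.
(* The estimate requires [v] to be harmonic too, which holds because directional derivatives
   commute. *)
have hv z : 'D_dtau ('D_dtau v) z + 'D_dt ('D_dt v) z = 0.
  have E1 : 'D_dt v = 'D_dtau ('D_dt u) := smooth_swap dt dtau su.
  have s2 := smooth_derive dt su.
  have E2 : 'D_dt ('D_dt v) = 'D_dtau ('D_dt ('D_dt u)) :=
    etrans (congr1 (fun f : plane -> R^o => 'D_dt f) E1) (smooth_swap dt dtau s2).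
  have E3 : 'D_dt ('D_dt u) = - 'D_dtau v.
    by apply/funext => y; apply: sum0 (hu y).
  have s3 := smooth_derive dtau sv.
  have dv : derivable ('D_dtau v) z dtau by case: (smooth_is_derive z dtau s3).
  have E4 : 'D_dtau (- 'D_dtau v) z = - 'D_dtau ('D_dtau v) z by exact: deriveN.
  apply: sum0'; exact: (etrans (congr1 (fun f : plane -> R^o => f z) E2)
    (etrans (congr1 (fun f : plane -> R^o => 'D_dtau f z) E3) E4)).
have per (f : plane -> R^o) : (forall z, f (z + dt) = f z) ->
    forall a b, f (a, b + 1) = f (a, b).
  move=> fp a b; have := fp (a, b); rewrite /d_t.
  by rewrite [(a, b) + _](_ : _ = (a, b + 1))//; congr pair; rewrite addr0.
have ct (f : plane -> R^o) : smooth_on setT f -> continuous f.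
  by move=> sf x; exact: (sf 0).
have est r : 0 < r ->
    r ^+ 4 * (v (a0, b0) : R) ^+ 2 <= 12 * r ^+ 2 * B ^+ 2 + r ^+ 2.
  move=> r0.
  apply: (@bernstein_estimate R u v
    (fun a b => 'D_dt u (a, b)) (fun a b => 'D_dt ('D_dt u) (a, b))
    (fun a b => 'D_dtau v (a, b)) (fun a b => 'D_dtau ('D_dtau v) (a, b))
    (fun a b => 'D_dt v (a, b)) (fun a b => 'D_dt ('D_dt v) (a, b))
    B r a0 b0 r0 (ct _ su) (ct _ sv) (per _ pu) (per _ pv) uB) => a b.
  - exact: deriv_tau.
  - exact: deriv_tau.
  - exact: deriv_tau (smooth_derive _ sv).
  - exact: deriv_t.
  - exact: deriv_t (smooth_derive _ su).
  - exact: deriv_t.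
  - exact: deriv_t (smooth_derive _ sv).
  - exact: hu.
  - exact: hv.
change (v (a0, b0) = 0); move: (v (a0, b0) : R) est => {hv pv sv}V est.
apply/eqP; rewrite -sqrf_eq0; apply/negP => /negP Vn0.
have V0 : 0 < V ^+ 2 by rewrite lt_neqAle eq_sym Vn0 sqr_ge0.
pose C := 12 * B ^+ 2 + 1.
have C0 : 0 < C by rewrite ltr_wpDl// mulr_ge0 ?sqr_ge0.
(* Then r > 1 and r V^2 > C, so r^2 V^2 > C, against the estimate. *)
pose r := C / V ^+ 2 + 1.
have r1 : 1 < r by rewrite ltrDr divr_gt0.
have r0 : 0 < r by rewrite (lt_trans ltr01).
have E1 : r ^+ 4 * V ^+ 2 = r ^+ 2 * (r ^+ 2 * V ^+ 2) by ring.
have E2 : 12 * r ^+ 2 * B ^+ 2 + r ^+ 2 = r ^+ 2 * C by rewrite /C; ring.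
have := est r r0; rewrite E1 E2.
rewrite ler_pM2l ?exprn_gt0// leNgt => /negP; apply.
apply: (@lt_trans _ _ (r * V ^+ 2)).
  by rewrite mulrDl mul1r mulfVK ?gt_eqF// ltrDl.
by rewrite ltr_pM2r// expr2 ltr_pMr.
Qed.

Lemma plane_decomp (v : plane) : v = v.1 *: dtau + v.2 *: dt.
Proof.
have sc (r s : R^o) : r *: s = r * s by [].
case: v => a b; rewrite /d_tau /d_t.
by congr pair => /=; rewrite !sc mulr1 mulr0 ?addr0 ?add0r.
Qed.

Lemma derive0_cst (f : plane -> R^o) : smooth_on setT f ->
  (forall z, 'D_dtau f z = 0) -> (forall z, 'D_dt f z = 0) ->
  forall z, f z = f 0.
Proof.
move=> sf f1 f2 z.
have Dz y : 'D_z f y = 0.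
  have df : differentiable f y by exact: smooth_differentiable.
  rewrite {1}(plane_decomp z).
  by rewrite derive_linDl// !derive_linZl// f1 f2 !scaler0 addr0.
have [s _|c _] := @MVT_closed R (fun s => f (0 + s *: z)) (fun=> 0) 0 1 ler01.
  by rewrite -(Dz (0 + s *: z)); apply: is_derive_line; exact: smooth_is_derive.
by rewrite mulr0 scale0r scale1r add0r addr0 => /eqP; rewrite subr_eq0 => /eqP.
Qed.

(** Both functions are harmonic, so their tau-derivatives vanish; the two equations then carry this
    over to the t-derivatives. *)
Lemma bounded_cauchy_riemann_cst (p q : plane -> R^o) (B : R) :
  smooth_on setT p -> smooth_on setT q ->
  (forall z, p (z + dt) = p z) -> (forall z, q (z + dt) = q z) ->
  (forall z, `|p z : R| <= B) -> (forall z, `|q z : R| <= B) ->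
  (forall z, 'D_dt p z = 'D_dtau q z) ->
  (forall z, 'D_dtau p z = - 'D_dt q z) ->
  (forall z, p z = p 0) /\ (forall z, q z = q 0).
Proof.
move=> sp sq pp pq pB qB h1 h2.
have Npar (f : plane -> R^o) v z : smooth_on setT f -> 'D_v (- f) z = - 'D_v f z.
  by move=> sf; apply: deriveN; case: (smooth_is_derive z v sf).
have h1' : 'D_dt p = 'D_dtau q by exact/funext.
have h2' : 'D_dtau p = - 'D_dt q by exact/funext.
have Sq := smooth_swap dtau dt sq.
have Sp := smooth_swap dtau dt sp.
have s1 := smooth_derive dt sq.
have s2 := smooth_derive dtau sp.
have app (v z : plane) (f g : plane -> R^o) : f = g -> 'D_v f z = 'D_v g z.
  by move=> ->.
have sum0 (x y z : R) : x = - z -> y = z -> x + y = 0.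
  by move=> -> ->; rewrite addNr.
have sum0' (x y z : R) : x = z -> y = - z -> x + y = 0.
  by move=> -> ->; rewrite subrr.
have p0 : forall z, 'D_dtau p z = 0.
  apply: (@bounded_harmonic_derive_tau p B sp pp pB) => z.
  apply: (sum0 _ _ ('D_dtau ('D_dt q) z)).
    exact: (etrans (app dtau z _ _ h2') (Npar ('D_dt q) dtau z s1)).
  exact: (etrans (app dt z _ _ h1') (congr1 (fun f : plane -> R^o => f z) (esym Sq))).
have q0 : forall z, 'D_dtau q z = 0.
  apply: (@bounded_harmonic_derive_tau q B sq pq qB) => z.
  have h2'' : 'D_dt q = - 'D_dtau p := esym (etrans (congr1 -%R h2') (opprK _)).
  apply: (sum0' _ _ ('D_dt ('D_dtau p) z)).
    exact: (etrans (app dtau z _ _ (esym h1')) (congr1 (fun f : plane -> R^o => f z) Sp)).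
  exact: (etrans (app dt z _ _ h2'') (Npar ('D_dtau p) dt z s2)).
split.
  exact: (derive0_cst sp p0 (fun z => etrans (h1 z) (q0 z))).
apply: (derive0_cst sq q0) => z.
by have /eqP := h2 z; rewrite p0 eq_sym oppr_eq0 => /eqP.
Qed.

End Liouville.

(** * Limits of geometric sequences, antiderivatives, and the clamp map *)

Section Picard.
Context {R : realType}.

Lemma exists_lt_halving (c e : R) : 0 < e -> exists k : nat, c < e * 2 ^+ k.
Proof.
move=> e0; have [c0|c0] := leP 0 c; last by exists 0%N; rewrite expr0 mulr1 (lt_trans c0).
exists (Num.bound (c / e)).
have : c / e < (Num.bound (c / e))%:R by apply: archi_boundP; rewrite divr_ge0// ltW.
rewrite ltr_pdivrMr// => /lt_le_trans; apply.
by rewrite mulrC ler_wpM2l ?(ltW e0)// -natrX ler_nat; exact/ltnW/ltn_expl.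
Qed.

Lemma halving_eq0 (x c : R) : 0 <= x -> (forall k : nat, x * 2 ^+ k <= c) -> x = 0.
Proof.
move=> x0 xc; apply/eqP; rewrite eq_le x0 andbT leNgt; apply/negP.
by move=> /(exists_lt_halving c)[k]; rewrite ltNge xc.
Qed.

(** In each coordinate the intervals of radius [c k] about [u k] are nested, [c k] being the sum of
    all later increments allowed by the hypothesis. The limit is the supremum of their left ends. *)
Lemma geometric_limit m (u : nat -> 'rV[R]_m) (C : R) : 0 <= C ->
  (forall k, `|u k.+1 - u k| * 2 ^+ k <= C) ->
  exists l, forall k, `|l - u k| * 2 ^+ k <= 2 * C.
Proof.
move=> C0 uC; pose c k := 2 * C / 2 ^+ k.
have p2 k : 0 < 2 ^+ k :> R by rewrite exprn_gt0.
have cE k : c k = C / 2 ^+ k + c k.+1.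
  rewrite /c exprS invfM mulrA mulrAC -!mulrA (mulrC _ C) !mulrA.
  by field; rewrite gt_eqF.
have uc k i : `|u k.+1 0 i - u k 0 i| <= C / 2 ^+ k.
  have := uC k; rewrite -ler_pdivlMr// => /row_norm_le H.
  by have := H (divr_ge0 C0 (ltW (p2 k))) i; rewrite !mxE.
have c0 k : 0 <= c k by rewrite divr_ge0// ?mulr_ge0// ltW.
have inc i k n : u k 0 i - c k <= u (k + n)%N 0 i - c (k + n)%N.
  elim: n => [|n IH]; first by rewrite addn0.
  apply: le_trans IH _; rewrite addnS (cE (k + n)%N).
  have := uc (k + n)%N i; rewrite ler_norml => /andP[+ _]; lra.
have dec i k n : u (k + n)%N 0 i + c (k + n)%N <= u k 0 i + c k.
  elim: n => [|n IH]; first by rewrite addn0.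
  apply: le_trans IH; rewrite addnS (cE (k + n)%N).
  have := uc (k + n)%N i; rewrite ler_norml => /andP[_]; lra.
have nest i k n : u k 0 i - c k <= u n 0 i + c n.
  have := inc i k (n - k)%N; have := dec i n (k - n)%N.
  have [kn|/ltnW nk] := leqP k n.
    rewrite (subnKC kn); have := c0 n; have := dec i n 0%N; lra.
  rewrite (subnKC nk); have := c0 k; lra.
pose A i := [set u k 0 i - c k | k in @setT nat].
have sA i : has_sup (A i).
  split; first by exists (u 0%N 0 i - c 0%N); exists 0%N.
  by exists (u 0%N 0 i + c 0%N) => _ [k _ <-].
exists (\row_i sup (A i)) => k; rewrite -ler_pdivlMr//.
apply/row_norm_le => [|i]; first exact: c0.
rewrite !mxE ler_norml; apply/andP; split.
  by rewrite lerBrDr addrC; apply: sup_upper_bound => //; exists k.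
rewrite lerBlDr addrC; apply: sup_le_ub; first by have [] := sA i.
by move=> _ [n _ <-].
Qed.

Lemma continuous_antiderivative (g : R -> R) (d : R) : 0 < d ->
  continuous (g : R^o -> R^o) ->
  exists G : R -> R, forall s, `|s| <= d -> deriv G s (g s).
Proof.
move=> d0 cg.
(* The margin 1 on both sides makes every [s] with [|s| <= d] an interior point, as the fundamental
   theorem of calculus requires. *)
exists (fun s => \int[lebesgue_measure]_(t in `[- d - 1, s]) g t)%R => s.
rewrite ler_norml => /andP[ds sd].
have sd1 : s < d + 1 by rewrite (le_lt_trans sd)// ltrDl.
have ds1 : - d - 1 < s by rewrite (lt_le_trans _ ds)// gtrDl oppr_lt0.
have ig : lebesgue_measure.-integrable `[- d - 1, d + 1] (EFin \o g).
  apply: continuous_compact_integrable; first exact: segment_compact.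
  exact: continuous_subspaceT.
have [G1 G2] := continuous_FTC1_closed sd1 ig ds1 (cg s).
by split; [exact: G1|rewrite -derive1E; exact: G2].
Qed.

Lemma continuous_antiderivative_row m (g : R -> 'rV[R]_m) (d : R) x0 : 0 < d ->
  continuous (g : R^o -> _) ->
  exists2 G : R -> 'rV[R]_m, G 0 = x0 &
  forall s : R, `|s| <= d -> is_derive (s : R^o) (1 : R^o) (G : R^o -> _) (g s).
Proof.
move=> d0 cg.
have /choice[G GP] (i : 'I_m) : exists Gi : R -> R,
    forall s, `|s| <= d -> deriv Gi s (g s 0 i).
  apply: continuous_antiderivative => // s.
  apply: (@continuous_comp _ _ _ g (fun M : 'rV[R]_m => M 0 i : R^o)).
    exact: cg.
  exact: coord_continuous.
exists (fun s => x0 + \row_i (G i s - G i 0)).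
  by apply/rowP => i; rewrite !mxE subrr addr0.
move=> s sd.
have dG i j : is_derive (s : R^o) (1 : R^o)
    (fun s => (x0 + \row_i (G i s - G i 0)) i j : R^o) (g s i j).
  have -> : (fun s => (x0 + \row_i (G i s - G i 0)) i j : R^o) =
      (fun s => x0 i j + (G j s + - G j 0)).
    by apply/funext => t; rewrite !mxE.
  apply: (@deriv_eq _ _ _ _ (0 + (g s 0 j + 0)) _ (fun=> erefl)).
    by rewrite (ord1 i) add0r addr0.
  by apply: deriv_add (deriv_cst _ _) (deriv_add (GP j s sd) (deriv_cst _ _)).
have D : derivable ((fun s => x0 + \row_i (G i s - G i 0)) : R^o -> 'rV[R]_m) s 1.
  by apply/derivable_mxP => i j; have [] := dG i j.
apply: DeriveDef => //; rewrite derive_mx//; apply/matrixP => i j; rewrite mxE.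
by have [_] := dG i j.
Qed.

Lemma is_derive_continuous (W : normedModType R) (y : R -> W) (s : R) dy :
  is_derive (s : R^o) (1 : R^o) (y : R^o -> W) dy -> {for s, continuous (y : R^o -> W)}.
Proof. by case=> /derivable1_diffP d _; exact: differentiable_continuous. Qed.

(** Maximum and minimum with a constant are 1-Lipschitz. *)
Lemma clamp_continuous (d : R) :
  continuous ((fun s : R => Num.max (- d) (Num.min s d)) : R^o -> R^o).
Proof.
move=> s; apply/cvgrPdist_lt => e e0.
have : \forall t \near (s : R^o), `|s - t| < e.
  by apply/nbhs_ballP; exists e.
have M1 (a x y : R) : `|Num.max a x - Num.max a y| <= `|x - y|.
  have [h1|h1] := leP a x; have [h2|h2] := leP a y; have [h3|h3] := ger0P (x - y);
    rewrite ?ler_norml ?lexx//; apply/andP; split; lra.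
have M2 (a x y : R) : `|Num.min x a - Num.min y a| <= `|x - y|.
  have [h1|h1] := leP x a; have [h2|h2] := leP y a; have [h3|h3] := ger0P (x - y);
    rewrite ?ler_norml ?lexx//; apply/andP; split; lra.
apply: filterS => t; apply: le_lt_trans.
exact: le_trans (M1 _ _ _) (M2 _ _ _).
Qed.


End Picard.

(** * Local existence and uniqueness for ordinary differential equations *)

Section ODE.
Context {R : realType}.

(* Picard iteration: the iterates are composed with the retraction onto [-d, d],
   so that all estimates hold on the whole line. *)
Lemma ode_local_existence m (U : set 'rV[R]_m) (F : 'rV[R]_m -> 'rV[R]_m) x0 :
  open U -> Ck 1 U F -> U x0 ->
  exists d, exists2 y : R -> 'rV[R]_m, 0 < d /\ y 0 = x0 &
    forall s : R, `|s| < d -> U (y s) /\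
      is_derive (s : R^o) (1 : R^o) (y : R^o -> _) (F (y s)).
Proof.
move=> oU CF Ux0.
have [K [r [K0 r0 rU FK]]] := C1_locally_lipschitz oU CF Ux0.
pose rho := r / 2; have rho0 : 0 < rho by rewrite divr_gt0.
have rhor : rho < r by rewrite ltr_pdivrMr// ltr_pMr// ltr1n.
pose M := `|F x0| + K * r.
have M0 : 0 <= M by rewrite addr_ge0// mulr_ge0// ltW.
(* This [d] meets two demands: [M * d <= rho] keeps the iterates within [rho] of [x0], and
   [K * d <= 2^-1] makes the iteration contract by one half. The summand 1 keeps the denominator
   positive. *)
pose d := rho / (M + K * r + 1).
have den : 0 < M + K * r + 1 by rewrite ltr_wpDl// addr_ge0// mulr_ge0// ltW.
have d0 : 0 < d by rewrite divr_gt0.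
have dE : rho = d * (M + K * r + 1) by rewrite mulfVK// gt_eqF.
have dM : M * d <= rho.
  by rewrite dE mulrC ler_pM2l// -addrA lerDl addr_ge0// mulr_ge0// ltW.
have dK : K * d <= 2^-1.
  have : d * (K * r) <= rho by rewrite dE ler_pM2l//; lra.
  have -> : d * (K * r) = r * (K * d) by ring.
  by rewrite /rho ler_pM2l.
have inball x : `|x - x0| <= rho -> ball x0 r x.
  by move=> xx; rewrite -ball_normE /ball_ /= distrC (le_lt_trans xx).
have FM x : `|x - x0| <= rho -> `|F x| <= M.
  move=> xx; have b0 : ball x0 r x0 by exact: ballxx.
  rewrite -[F x](subrK (F x0)) (le_trans (ler_normD _ _))// addrC lerD2l.
  rewrite (le_trans (FK _ _ (inball _ xx) b0))// ler_wpM2l//.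
  exact: le_trans xx (ltW rhor).
pose clamp s := Num.max (- d) (Num.min s d).
have clampd s : `|clamp s| <= d.
  rewrite /clamp ler_norml le_max lexx/= ge_max ge_min lexx orbT andbT.
  by rewrite ge0_cp// ltW.
have clampE s : `|s| <= d -> clamp s = s.
  by rewrite ler_norml /clamp => /andP[ds sd]; rewrite min_l// max_r.
pose D (y : R -> 'rV[R]_m) :=
  continuous (y : R^o -> _) /\ forall s, `|y s - x0| <= rho.
(* [G] is the Picard integral of [y] on [-d, d], described by its value at 0 and its derivative;
   [choice] then selects one such [h] as [Phi y]. *)
pose step (y h : R -> 'rV[R]_m) := D h /\ exists G : R -> 'rV[R]_m,
  [/\ G 0 = x0, forall s, h s = G (clamp s) &
    forall s : R, `|s| <= d ->
      is_derive (s : R^o) (1 : R^o) (G : R^o -> _) (F (y s))].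
have /choice[Phi PhiP] (y : R -> 'rV[R]_m) : exists h, D y -> step y h.
  have [Dy|nDy] := pselect (D y); last by exists y.
  have [cy yb] := Dy.
  have cFy : continuous (F \o y : R^o -> _).
    move=> s; apply: continuous_comp; first exact: cy.
    apply: (Ck_continuous CF); apply: rU; exact: inball.
  have [G G0 dG] := continuous_antiderivative_row x0 d0 cFy.
  exists (G \o clamp) => _; split; last by exists G.
  split=> s.
    apply: (@continuous_comp _ _ _ (clamp : R^o -> R^o) G).
      exact: clamp_continuous.
    exact: is_derive_continuous (dG _ (clampd s)).
  have := @mean_value_bound R m G (F \o y) 0 (clamp s) M M0.
  rewrite G0 subr0 => H; apply: (le_trans (H _)); last first.
    by rewrite (le_trans _ dM)// ler_wpM2l.
  move=> t; have := clampd s; rewrite ler_norml => /andP[c1 c2].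
  rewrite ge_min le_max => /andP[t1 t2].
  split; last by apply: FM; exact: yb.
  apply: dG; rewrite ler_norml; apply/andP; split.
    by case/orP: t1; lra.
  by case/orP: t2; lra.
have contr y1 y2 c : 0 <= c -> D y1 -> D y2 -> (forall s, `|y1 s - y2 s| <= c) ->
    forall s, `|Phi y1 s - Phi y2 s| <= c / 2.
  move=> c0 D1 D2 y12 s.
  have [_ [G1 [G10 -> dG1]]] := PhiP _ D1.
  have [_ [G2 [G20 -> dG2]]] := PhiP _ D2.
  have Kc0 : 0 <= K * c by rewrite mulr_ge0.
  have := @mean_value_bound R m (fun s => G1 s - G2 s)
    (fun s => F (y1 s) - F (y2 s)) 0 (clamp s) _ Kc0.
  rewrite G10 G20 subrr !subr0 => H; apply: (le_trans (H _)); last first.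
    rewrite (mulrC K) -mulrA ler_wpM2l//; apply: le_trans dK.
    by rewrite ler_wpM2l.
  move=> t; have := clampd s; rewrite ler_norml => /andP[e1 e2].
  rewrite ge_min le_max => /andP[t1 t2].
  have td : `|t| <= d.
    rewrite ler_norml; apply/andP; split; first by case/orP: t1; lra.
    by case/orP: t2; lra.
  split; first by apply: is_deriveB; [exact: dG1|exact: dG2].
  apply: le_trans (FK _ _ _ _) _; [by apply: inball; case: D1|by apply: inball; case: D2|].
  by rewrite ler_wpM2l.
pose u k := iter k Phi (fun=> x0).
have Du k : D (u k).
  elim: k => [|k /PhiP[]//]; split=> [s|s]; first exact: cst_continuous.
  by rewrite subrr normr0 ltW.
have p2 k : 0 < 2 ^+ k :> R by rewrite exprn_gt0.
have uS k : forall s, `|u k.+1 s - u k s| <= rho / 2 ^+ k.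
  elim: k => [s|k IH].
    by rewrite expr0 divr1; have [_] := Du 1%N; apply.
  have c0 : 0 <= rho / 2 ^+ k by rewrite divr_ge0// ltW.
  rewrite exprSr invfM mulrA => s.
  exact: (contr (u k.+1) (u k) _ c0 (Du k.+1) (Du k) IH).
have /choice[y yP] s : exists l, forall k, `|l - u k s| * 2 ^+ k <= 2 * rho.
  apply: (@geometric_limit _ _ (fun k => u k s) rho (ltW rho0)).
  by move=> j; rewrite -ler_pdivlMr.
have Dy : D y.
  split=> s; last first.
    apply/ler_addgt0Pr => e e0.
    have [k ke] := exists_lt_halving (2 * rho) e0.
    rewrite -(subrKA (u k s)) (le_trans (ler_normD _ _))// addrC lerD//.
      by have [_] := Du k; apply.
    by rewrite -(ler_pM2r (p2 k)) (le_trans (yP _ _))// ltW.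
  apply/cvgrPdist_lt => e e0.
  have e3 : 0 < e / 3 by rewrite divr_gt0.
  have [k ke] := exists_lt_halving (2 * rho) e3.
  have yu t : `|y t - u k t| < e / 3.
    by rewrite -(ltr_pM2r (p2 k)) (le_lt_trans (yP _ _)).
  have [cu _] := Du k.
  have /cvgrPdist_lt/(_ _ e3) := cu s.
  apply: filterS => t st.
  have -> : y s - y t = (y s - u k s) + (u k s - u k t) + (u k t - y t).
    by rewrite subrKA subrKA.
  rewrite (_ : e = e / 3 + e / 3 + e / 3); last by field.
  rewrite (le_lt_trans (ler_normD _ _))// ltrD//; last by rewrite distrC.
  by rewrite (le_lt_trans (ler_normD _ _))// ltrD.
have [_ [G [G0 PhiE dG]]] := PhiP _ Dy.
(* Both [y] and [Phi y] are close to [u k.+1], within 2 rho / 2^k and rho / 2^k respectively, so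
   their distance is at most 3 rho / 2^k for every k. *)
have yE : y = G \o clamp.
  apply/funext => s /=; rewrite -PhiE; apply/eqP; rewrite -subr_eq0 -normr_eq0.
  apply/eqP; apply: (@halving_eq0 _ _ (3 * rho)) => // k.
  rewrite -ler_pdivlMr// -(subrKA (u k.+1 s)) (le_trans (ler_normD _ _))//.
  have H1 : `|u k.+1 s - Phi y s| <= rho / 2 ^+ k.
    have c0 : 0 <= 2 * rho / 2 ^+ k by rewrite divr_ge0// ?mulr_ge0// ltW.
    have -> : rho / 2 ^+ k = 2 * rho / 2 ^+ k / 2 by field; rewrite gt_eqF.
    apply: (contr (u k) y _ c0 (Du k) Dy) => t.
    by rewrite distrC ler_pdivlMr.
  have H2 : `|y s - u k.+1 s| <= 2 * rho / 2 ^+ k.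
    rewrite ler_pdivlMr//; apply: le_trans (yP s k.+1).
    by rewrite ler_wpM2l// exprS ler_peMl ?ler1n// ltW.
  rewrite (le_trans (lerD H2 H1))// -mulrDl ler_pM2r ?invr_gt0//.
  by lra.
exists d, y.
  by split=> //; rewrite yE /= clampE ?normr0// ltW.
move=> s sd; split.
  by apply: rU; apply: inball; case: Dy.
(* [y] is known to equal [G] only on [-d, d]; the strict bound on [s] gives agreement near [s]. *)
apply: (@near_eq_is_derive _ _ _ (G : R^o -> _)).
  have : \forall t \near (s : R^o), `|t| < d.
    apply/nbhs_ballP; exists (d - `|s|); first by rewrite /= subr_gt0.
    move=> t; rewrite /ball /= ltrBrDl; apply: le_lt_trans.
    by rewrite -[in leLHS](subrKC s t) (le_trans (ler_normD _ _))// lerD2l distrC.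
  by apply: filterS => t /ltW td; rewrite yE /= clampE.
exact: dG (ltW sd).
Qed.

(** On an interval about [s0] so short that [K * d <= 2^-1], each use of the mean value bound halves
    the estimate of the difference, which starts from 2 r. This replaces Gronwall's inequality. *)
Lemma ode_local_uniqueness m (U : set 'rV[R]_m) (F : 'rV[R]_m -> 'rV[R]_m)
    (y1 y2 : R -> 'rV[R]_m) (s0 : R) :
  open U -> Ck 1 U F -> U (y1 s0) -> y1 s0 = y2 s0 ->
  (\forall s \near (s0 : R^o),
    is_derive (s : R^o) (1 : R^o) (y1 : R^o -> _) (F (y1 s)) /\
    is_derive (s : R^o) (1 : R^o) (y2 : R^o -> _) (F (y2 s))) ->
  \forall s \near (s0 : R^o), y1 s = y2 s.
Proof.
move=> oU CF Uy y12 dy.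
have [K [r [K0 r0 rU FK]]] := C1_locally_lipschitz oU CF Uy.
have [d1 d2] := nbhs_singleton dy.
have n1 : \forall s \near (s0 : R^o), ball (y1 s0) r (y1 s).
  by apply: (is_derive_continuous d1); exact: nbhsx_ballx.
have n2 : \forall s \near (s0 : R^o), ball (y1 s0) r (y2 s).
  by rewrite y12; apply: (is_derive_continuous d2); exact: nbhsx_ballx.
have /nbhs_ballP[e /= e0 eP] : \forall s \near (s0 : R^o),
    (is_derive (s : R^o) (1 : R^o) (y1 : R^o -> _) (F (y1 s)) /\
     is_derive (s : R^o) (1 : R^o) (y2 : R^o -> _) (F (y2 s))) /\
    (ball (y1 s0) r (y1 s) /\ ball (y1 s0) r (y2 s)).
  by apply: filterI => //; exact: filterI.
pose d := Num.min e (2 * (K + 1))^-1.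
have d0 : 0 < d by rewrite lt_min e0 invr_gt0; lra.
have dK : K * d <= 2^-1.
  apply: (@le_trans _ _ ((K + 1) * (2 * (K + 1))^-1)).
    by rewrite ler_pM ?(ltW d0)// ?lerDl// ge_min lexx orbT.
  have ? : K + 1 != 0 by rewrite gt_eqF//; lra.
  by rewrite invfM mulrCA divff ?mulr1.
have dP s : `|s - s0| < d -> [/\
    is_derive (s : R^o) (1 : R^o) (y1 : R^o -> _) (F (y1 s)),
    is_derive (s : R^o) (1 : R^o) (y2 : R^o -> _) (F (y2 s)),
    ball (y1 s0) r (y1 s) & ball (y1 s0) r (y2 s)].
  move=> sd; have [] := eP s.
    by rewrite /ball /= distrC (lt_le_trans sd)// ge_min lexx.
  by case=> ? ? [].
have p2 k : 0 < 2 ^+ k :> R by rewrite exprn_gt0.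
have bnd k : forall s, `|s - s0| < d -> `|y1 s - y2 s| <= 2 * r / 2 ^+ k.
  elim: k => [s /dP[_ _ b1 b2]|k IH s sd].
    rewrite expr0 divr1 -(subrKA (y1 s0)) (le_trans (ler_normD _ _))//.
    move: b1 b2; rewrite -!ball_normE /ball_ /= => /ltW b1 /ltW b2.
    by rewrite mulr2n mulrDl mul1r lerD// distrC.
  have c0 : 0 <= 2 * r / 2 ^+ k by rewrite divr_ge0 ?mulr_ge0 ?(ltW r0) ?(ltW (p2 k)).
  have Kc0 : 0 <= K * (2 * r / 2 ^+ k) by rewrite mulr_ge0.
  have := @mean_value_bound R m (fun s => y1 s - y2 s)
    (fun s => F (y1 s) - F (y2 s)) s0 s _ Kc0.
  rewrite y12 subrr subr0 => H; apply: (le_trans (H _)); last first.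
    rewrite (_ : 2 * r / 2 ^+ k.+1 = 2 * r / 2 ^+ k * 2^-1); last first.
      by rewrite exprSr invfM mulrA.
    rewrite (mulrC K) -[leLHS]mulrA; apply: ler_wpM2l => //.
    by apply: le_trans dK; rewrite ler_wpM2l// ltW.
  move=> t; rewrite ge_min le_max => /andP[t1 t2].
  have td : `|t - s0| < d.
    move: sd; rewrite !ltr_norml => /andP[h1 h2]; apply/andP; split.
      by case/orP: t1; lra.
    by case/orP: t2; lra.
  have [D1 D2 b1 b2] := dP _ td.
  split; first exact: is_deriveB.
  by rewrite (le_trans (FK _ _ b1 b2))// ler_wpM2l// IH.
apply/nbhs_ballP; exists d => //= s; rewrite /ball /= distrC => sd.
apply/eqP; rewrite -subr_eq0 -normr_eq0; apply/eqP.
apply: (@halving_eq0 _ _ (2 * r)) => // k.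
by rewrite -ler_pdivlMr// bnd.
Qed.

End ODE.

(** * Change of charts for maps and tangent vectors *)

Section Charts.
Context {R : realType} {m : nat} {M : manifold R m}.
Local Notation E := 'rV[R]_m.+1.
Implicit Types (c d : chart R m M) (p : M).

Lemma chart_open_dom c : atlas c -> open (cdom c).
Proof. by case/atlas_chart. Qed.

Lemma chart_open_img c : atlas c -> open (cimg c).
Proof. by case/atlas_chart. Qed.

Lemma chartK c p : atlas c -> cdom c p -> cinv c (cmap c p) = p.
Proof. by case/atlas_chart=> _ _ + _ _; apply. Qed.

Lemma cinv_continuous c x : atlas c -> cimg c x -> {for x, continuous (cinv c)}.
Proof. by case/atlas_chart=> _ _ _ _; apply. Qed.

Lemma cimg_cmap c p : cdom c p -> cimg c (cmap c p).
Proof. by move=> cp; exists p. Qed.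

Lemma cimgP c x : atlas c -> cimg c x ->
  cdom c (cinv c x) /\ cmap c (cinv c x) = x.
Proof. by move=> ac [p cp <-]; rewrite chartK. Qed.

Lemma overlap_img c d x : atlas c ->
  (cmap c @` (cdom c `&` cdom d)) x <-> cimg c x /\ cdom d (cinv c x).
Proof.
move=> ac; split=> [[p [cp dp] <-]|[cx dx]].
  by rewrite chartK//; split=> //; exact: cimg_cmap.
by have [cp E] := cimgP ac cx; exists (cinv c x).
Qed.

Lemma overlap_open c d : atlas c -> atlas d ->
  open (cmap c @` (cdom c `&` cdom d)).
Proof.
move=> ac ad; rewrite openE => x /(overlap_img _ _ ac)[cx dx].
have n1 : nbhs x (cimg c) by apply: open_nbhs_nbhs; split=> //; exact: chart_open_img.
have n2 : nbhs x (cinv c @^-1` cdom d).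
  apply: (cinv_continuous ac cx).
  by apply: open_nbhs_nbhs; split=> //; exact: chart_open_dom.
by apply: filterS2 n1 n2 => y cy dy; apply/(overlap_img _ _ ac).
Qed.

Lemma transition_differentiable c d p : atlas c -> atlas d ->
  cdom c p -> cdom d p -> differentiable (cmap d \o cinv c) (cmap c p).
Proof.
move=> ac ad cp dp; apply: (smooth_differentiable (atlas_compat ac ad)).
by exists p.
Qed.

Section Maps.
Context {V : normedModType R}.
Implicit Type f : V -> M.

(** Continuity is a separate clause: [cmap] is a total function, arbitrary off its domain, so
    differentiability of the composite does not keep [f] inside the chart near [z]. *)
Definition chart_diff f z : Prop :=
  {for z, continuous f} /\ differentiable (cmap (chart_at (f z)) \o f) z.

Lemma near_dom f z c : atlas c -> {for z, continuous f} -> cdom c (f z) ->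
  \forall y \near z, cdom c (f y).
Proof.
move=> ac cf cz; apply: cf.
by apply: open_nbhs_nbhs; split=> //; exact: chart_open_dom.
Qed.

Lemma near_chart_change f z c d : atlas c -> {for z, continuous f} ->
  cdom c (f z) ->
  \forall y \near z, ((cmap d \o cinv c) \o (cmap c \o f)) y = (cmap d \o f) y.
Proof.
move=> ac cf cz; have := near_dom ac cf cz.
by apply: filterS => y cy /=; rewrite chartK.
Qed.

(** Near [z] the map [cmap d \o f] is the transition map after [cmap c \o f], so this is the chain
    rule. *)
Lemma chart_change f z c d : atlas c -> atlas d -> {for z, continuous f} ->
  cdom c (f z) -> cdom d (f z) -> differentiable (cmap c \o f) z ->
  differentiable (cmap d \o f) z /\ forall v,
  'D_v (cmap d \o f) z = 'D_('D_v (cmap c \o f) z) (cmap d \o cinv c) (cmap c (f z)).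
Proof.
move=> ac ad cf cz dz df.
have nE := near_chart_change d ac cf cz.
have dt := transition_differentiable ac ad cz dz.
split=> [|v].
  by apply: near_eq_differentiable nE _; exact: differentiable_comp.
by rewrite -(near_eq_derive _ nE) (derive_compE _ df dt).
Qed.

Lemma chart_diff_differentiable f z c : atlas c -> chart_diff f z ->
  cdom c (f z) -> differentiable (cmap c \o f) z.
Proof.
move=> ac [cf df] cz.
by have [] := chart_change (chart_at_atlas _) ac cf (chart_at_dom _) cz df.
Qed.

Lemma derive_chart f z c v : atlas c -> chart_diff f z -> cdom c (f z) ->
  'D_v (cmap c \o f) z = tcomp c (f z) (dmap f z v).
Proof.
move=> ac [cf df] cz.
by have [_ ->] := chart_change (chart_at_atlas _) ac cf (chart_at_dom _) cz df.
Qed.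

Lemma smooth_chart_diff f z : smooth_map f -> chart_diff f z.
Proof.
move=> [cf sf]; split; first exact: cf.
apply: (smooth_differentiable (sf _ (chart_at_atlas _))).
exact: chart_at_dom.
Qed.

Lemma dmapZ f z k v : chart_diff f z -> dmap f z (k *: v) = k *: dmap f z v.
Proof. by case=> _ df; exact: derive_linZl. Qed.

Lemma dmapD f z u v : chart_diff f z -> dmap f z (u + v) = dmap f z u + dmap f z v.
Proof. by case=> _ df; exact: derive_linDl. Qed.

End Maps.

Lemma cinv_chart_diff c x : atlas c -> cimg c x -> chart_diff (cinv c) x.
Proof.
move=> ac cx; split; first exact: cinv_continuous.
have [cp E] := cimgP ac cx.
rewrite -[x in differentiable _ x]E.
exact: (transition_differentiable ac (chart_at_atlas _) cp (chart_at_dom _)).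
Qed.

Lemma tcompZ c p k v : atlas c -> cdom c p ->
  tcomp c p (k *: v) = k *: tcomp c p v.
Proof.
move=> ac cp; apply: derive_linZl.
exact: (transition_differentiable (chart_at_atlas p) ac (chart_at_dom p) cp).
Qed.

Lemma tcompD c p u v : atlas c -> cdom c p ->
  tcomp c p (u + v) = tcomp c p u + tcomp c p v.
Proof.
move=> ac cp; apply: derive_linDl.
exact: (transition_differentiable (chart_at_atlas p) ac (chart_at_dom p) cp).
Qed.

(** The two transition maps between [c] and [chart_at p] compose to the identity near the image of
    [p]; differentiating this shows that the changes of components are inverse to each other. *)
Lemma dmap_tcomp c p v : atlas c -> cdom c p ->
  dmap (cinv c) (cmap c p) (tcomp c p v) = v.
Proof.
move=> ac cp; have ac0 := chart_at_atlas p; have cp0 := chart_at_dom p.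
have Kp := chartK ac0 cp0.
have cx0 := cimg_cmap cp0.
have cc : {for cmap (chart_at p) p, continuous (cinv (chart_at p))}.
  exact: cinv_continuous.
have := @chart_change _ (cinv (chart_at p)) (cmap (chart_at p) p) c
  (chart_at p) ac ac0 cc.
rewrite Kp => /(_ cp cp0)[].
  by apply: (transition_differentiable ac0 ac cp0 cp).
move=> _ /(_ v) H.
rewrite /dmap chartK// -H -[RHS](derive_id (cmap (chart_at p) p) v).
apply: near_eq_derive.
apply: (near_open (chart_open_img ac0)) => // y cy /=.
by have [_] := cimgP ac0 cy.
Qed.

(** The left-hand side uses the chart [chart_at (f z)], which changes with [z]; the right-hand side
    uses a fixed [c] and can therefore be differentiated in [z]. *)
Lemma pullback_chart (V : normedModType R) (f : V -> M) (lam : M -> E -> R) c z v :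
  atlas c -> chart_diff f z -> cdom c (f z) ->
  pullback f lam z v =
  pullback (cinv c) lam (cmap c (f z)) ('D_v (cmap c \o f) z).
Proof.
move=> ac df cz; rewrite (derive_chart v ac df cz) /pullback.
by rewrite dmap_tcomp// chartK.
Qed.

End Charts.

(** * The exterior derivative commutes with pullback *)

Section ExteriorDerivative.
Context {R : realType}.

Lemma scalar_row m (f : 'rV[R]_m -> R) (v : 'rV[R]_m) : scalar f ->
  f v = \sum_i v 0 i * f (delta_mx 0 i).
Proof.
move=> lf.
have f0 : f 0 = 0.
  by have := lf (-1) 0 0; rewrite scaler0 addr0 mulN1r addNr.
have fZ k u : f (k *: u) = k * f u.
  by have := lf k u 0; rewrite !addr0 f0 addr0.
have fD u w : f (u + w) = f u + f w.
  by have := lf 1 u w; rewrite scale1r mul1r.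
rewrite {1}(row_sum_delta v).
elim/big_rec2: _ => [|i y1 y2 _ IH]; first exact: f0.
by rewrite fD fZ IH.
Qed.

(* [d (phi^* beta) = phi^* (d beta)]; the second derivatives of [phi] cancel. *)
Lemma ext_d_pullback (V : normedModType R) m (U : set V) (U' : set 'rV[R]_m)
    (phi : V -> 'rV[R]_m) (alpha : V -> V -> R) (beta : 'rV[R]_m -> 'rV[R]_m -> R)
    (z u v : V) :
  open U -> open U' -> U z -> (forall x, U x -> U' (phi x)) ->
  Ck 2 U phi ->
  (forall y, U' y -> scalar (beta y)) ->
  (forall e, Ck 1 U' (fun y => beta y e : R^o)) ->
  (forall x e, U x -> alpha x e = beta (phi x) ('D_e phi x)) ->
  ext_d alpha z u v = ext_d beta (phi z) ('D_u phi z) ('D_v phi z).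
Proof.
move=> oU oU' Uz UU' Cphi lb Cb aE.
have [dphi Dphi] := Cphi.
have key (a b : V) : 'D_a (fun y => alpha y b : R^o) z =
    'D_('D_a phi z) (fun y => beta y ('D_b phi z) : R^o) (phi z) +
    \sum_i 'D_a ('D_b phi) z 0 i * beta (phi z) (delta_mx 0 i).
  pose g i (x : V) : R^o := 'D_b phi x 0 i * beta (phi x) (delta_mx 0 i).
  have db i : is_derive z a (fun x : V => beta (phi x) (delta_mx 0 i) : R^o)
      ('D_('D_a phi z) (fun y => beta y (delta_mx 0 i) : R^o) (phi z)).
    have dphiz := dphi _ Uz.
    have dbz : differentiable (fun y => beta y (delta_mx 0 i) : R^o) (phi z).
      by have [+ _] := Cb (delta_mx 0 i); apply; exact: UU'.
    split; first exact: (@diff_derivable _ _ _ ((fun y => beta y (delta_mx 0 i) : R^o) \o phi) z a (differentiable_comp dphiz dbz)).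
    exact: (derive_compE a dphiz dbz).
  have dD : derivable ('D_b phi) z a.
    by apply: diff_derivable; have [+ _] := Dphi b; apply.
  have dp i : is_derive z a (fun x : V => 'D_b phi x 0 i : R^o)
      ('D_a ('D_b phi) z 0 i).
    split; last exact: derive_coord.
    by have /derivable_mxP := dD; apply.
  have dg i : is_derive z a (g i) ('D_b phi z 0 i *
      'D_('D_a phi z) (fun y => beta y (delta_mx 0 i) : R^o) (phi z) +
      beta (phi z) (delta_mx 0 i) * 'D_a ('D_b phi) z 0 i).
    exact: (is_deriveM (f := fun x : V => 'D_b phi x 0 i)
      (g := fun x : V => beta (phi x) (delta_mx 0 i))).
  have -> : 'D_a (fun y => alpha y b : R^o) z = 'D_a (\sum_i g i) z.
    apply: near_eq_derive; apply: (near_open oU) => // x Ux.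
    by rewrite aE// fct_sumE scalar_row//; apply: lb; exact: UU'.
  have dgz i : derivable (g i) z a by case: (dg i).
  rewrite derive_sum//.
  have -> : 'D_('D_a phi z) (fun y => beta y ('D_b phi z) : R^o) (phi z) =
    \sum_i 'D_b phi z 0 i *
      'D_('D_a phi z) (fun y => beta y (delta_mx 0 i) : R^o) (phi z).
    pose h i (y : 'rV[R]_m) : R^o := beta y (delta_mx 0 i).
    have dh i : derivable (h i) (phi z) ('D_a phi z).
      apply: diff_derivable; have [dCb _] := Cb (delta_mx 0 i).
      exact: dCb _ (UU' _ Uz).
    rewrite (_ : 'D__ _ _ = 'D_('D_a phi z) (\sum_i ('D_b phi z 0 i) *: h i) (phi z)).
      rewrite derive_sum; first by apply: eq_bigr => i _; rewrite deriveZ.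
      by move=> i; exact: derivableZ.
    apply: near_eq_derive; apply: (near_open oU') => [|y Uy]; first exact: UU'.
    by rewrite fct_sumE scalar_row//; exact: lb.
  rewrite -big_split/=; apply: eq_bigr => i _.
  have [_ ->] := dg i; congr (_ + _); exact: mulrC.
(* [derive_swap] concerns scalar functions, so the symmetry is obtained coordinate by coordinate. *)
have Eswap i : 'D_u ('D_v phi) z 0 i = 'D_v ('D_u phi) z 0 i.
  have Ci := Ck_coord i oU Cphi.
  have coordD (a b : V) : 'D_a ('D_b phi) z 0 i =
      'D_a ('D_b (fun x => phi x 0 i : R^o)) z.
    have dDb : derivable ('D_b phi) z a.
      by apply: diff_derivable; have [+ _] := Dphi b; apply.
    rewrite -(derive_coord i dDb).
    apply: near_eq_derive; apply: (near_open oU) => // x Ux.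
    apply/esym; apply: (@derive_coord _ _ _ phi).
    by apply: diff_derivable; exact: dphi.
  exact: (etrans (coordD u v) (etrans (derive_swap u v oU Ci Uz) (esym (coordD v u)))).
have alg (a b s t : R) : s = t -> a + s - (b + t) = a - b.
  by move=> ->; rewrite opprD addrACA subrr addr0.
have sumE (f g h : 'I_m -> R) : (forall i, f i = g i) ->
    \sum_i f i * h i = \sum_i g i * h i.
  by move=> fg; apply: eq_bigr => i _; rewrite fg.
rewrite /ext_d !key.
exact: (alg _ _ _ _ (sumE (fun i => 'D_u ('D_v phi) z 0 i)
  (fun i => 'D_v ('D_u phi) z 0 i) (fun i => beta (phi z) (delta_mx 0 i)) Eswap)).
Qed.

End ExteriorDerivative.

(** * One-forms on a manifold and their pullbacks *)

Section OneForms.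
Context {R : realType}.

Lemma Ck_local (V W : normedModType R) k (f : V -> W) :
  (forall x, exists U, [/\ open U, U x & Ck k U f]) -> Ck k setT f.
Proof.
elim: k f => [|k IH] f fP.
  by move=> x _; have [U [_ Ux]] := fP x; apply.
split=> [x _|v].
  by have [U [_ Ux [+ _]]] := fP x; apply.
by apply: IH => x; have [U [oU Ux [_ Df]]] := fP x; exists U; split=> //; exact: Df.
Qed.

Lemma scalar_fun0 (V : lmodType R) (f : V -> R) : scalar f -> f 0 = 0.
Proof. by move=> lf; have := lf (-1) 0 0; rewrite scaler0 addr0 mulN1r addNr. Qed.

Lemma scalar_funZ (V : lmodType R) (f : V -> R) k u : scalar f -> f (k *: u) = k * f u.
Proof. by move=> lf; have := lf k u 0; rewrite (scalar_fun0 lf) !addr0. Qed.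

Lemma scalar_funD (V : lmodType R) (f : V -> R) u v : scalar f -> f (u + v) = f u + f v.
Proof. by move=> lf; have := lf 1 u v; rewrite scale1r mul1r. Qed.

(** Linearity in a direction of differentiation comes from differentiability, linearity in the other
    argument from that of [alpha]. The expansion serves both the homogeneity of [dform] and the
    continuity of the energy density. *)
Lemma ext_d_row m (U : set 'rV[R]_m) (alpha : 'rV[R]_m -> 'rV[R]_m -> R)
    (x u v : 'rV[R]_m) :
  open U -> U x -> (forall y, U y -> scalar (alpha y)) ->
  (forall e, Ck 1 U (fun y => alpha y e : R^o)) ->
  ext_d alpha x u v = \sum_i \sum_j u 0 i * (v 0 j *
    ext_d alpha x (delta_mx 0 i) (delta_mx 0 j)).
Proof.
move=> oU Ux la Ca.
pose h j (y : 'rV[R]_m) : R^o := alpha y (delta_mx 0 j).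
have dh j : differentiable (h j) x.
  by have [dC _] := Ca (delta_mx 0 j); exact: dC.
have D1 (a b : 'rV[R]_m) : 'D_a (fun y => alpha y b : R^o) x =
    \sum_j b 0 j * 'D_a (h j) x.
  have dha j : derivable (h j) x a by exact: diff_derivable.
  have -> : 'D_a (fun y => alpha y b : R^o) x = 'D_a (\sum_j (b 0 j *: h j)) x.
    apply: near_eq_derive; apply: (near_open oU) => // y Uy.
    by rewrite fct_sumE scalar_row//; exact: la.
  rewrite derive_sum; first by apply: eq_bigr => j _; rewrite deriveZ.
  by move=> j; exact: derivableZ.
have D2 (a b : 'rV[R]_m) : 'D_a (fun y => alpha y b : R^o) x =
    \sum_i \sum_j a 0 i * (b 0 j * 'D_(delta_mx 0 i) (h j) x).
  rewrite D1 exchange_big /=; apply: eq_bigr => j _.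
  rewrite derive_rowE// mulr_sumr; apply: eq_bigr => i _.
  exact: mulrCA.
have E : 'D_v (fun y => alpha y u : R^o) x =
    \sum_i \sum_j u 0 i * (v 0 j * 'D_(delta_mx 0 j) (h i) x).
  rewrite D2 exchange_big; apply: eq_bigr => i _; apply: eq_bigr => j _.
  exact: mulrCA.
rewrite /ext_d D2 E -sumrB; apply: eq_bigr => i _.
by rewrite -sumrB; apply: eq_bigr => j _; rewrite -!mulrBr.
Qed.

Context {m : nat} {M : manifold R m}.
Local Notation E := 'rV[R]_m.+1.
Variable lam : M -> E -> R.
Hypothesis smooth_lam : smooth_one_form lam.

Lemma pullback_scalar (V : normedModType R) (f : V -> M) z : chart_diff f z ->
  scalar (pullback f lam z).
Proof.
move=> df k u v; have [llam _] := smooth_lam.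
by rewrite /pullback dmapD// dmapZ// llam.
Qed.

Lemma pullback_cinv_scalar (c : chart R m M) x : atlas c -> cimg c x ->
  scalar (pullback (cinv c) lam x).
Proof. by move=> ac cx; exact/pullback_scalar/cinv_chart_diff. Qed.

Lemma pullback_cinv_smooth (c : chart R m M) e : atlas c ->
  smooth_on (cimg c) (fun x => pullback (cinv c) lam x e : R^o).
Proof. by move=> ac; have [_] := smooth_lam; apply. Qed.

(** This is [ext_d_pullback] for the transition map from [chart_at p] to [c]. It frees [dform] from
    the preferred chart, so that [p] can vary within [c]. *)
Lemma dform_chart (c : chart R m M) (p : M) (u v : E) : atlas c -> cdom c p ->
  dform lam p u v =
  ext_d (pullback (cinv c) lam) (cmap c p) (tcomp c p u) (tcomp c p v).
Proof.
move=> ac cp; have ac0 := chart_at_atlas p; have cp0 := chart_at_dom p.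
have oU := overlap_open ac0 ac.
have Cphi : Ck 2 (cmap (chart_at p) @` (cdom (chart_at p) `&` cdom c))
    (cmap c \o cinv (chart_at p)) by exact: (atlas_compat ac0 ac 2).
have Uz : (cmap (chart_at p) @` (cdom (chart_at p) `&` cdom c)) (cmap (chart_at p) p).
  by exists p.
have UU' x : (cmap (chart_at p) @` (cdom (chart_at p) `&` cdom c)) x ->
    cimg c ((cmap c \o cinv (chart_at p)) x).
  by move=> [q [q0 qc] <-] /=; rewrite chartK//; exact: cimg_cmap.
have lb y : cimg c y -> scalar (pullback (cinv c) lam y).
  exact: pullback_cinv_scalar.
have Cb e : Ck 1 (cimg c) (fun y => pullback (cinv c) lam y e : R^o).
  exact: (pullback_cinv_smooth e ac 1).
have aE x e : (cmap (chart_at p) @` (cdom (chart_at p) `&` cdom c)) x ->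
    pullback (cinv (chart_at p)) lam x e = pullback (cinv c) lam
      ((cmap c \o cinv (chart_at p)) x) ('D_e (cmap c \o cinv (chart_at p)) x).
  move=> /(overlap_img _ _ ac0)[x0 xc].
  by apply: pullback_chart => //; exact: cinv_chart_diff.
have := ext_d_pullback u v oU (chart_open_img ac) Uz UU' Cphi lb Cb aE.
by rewrite [(cmap c \o _) _]/= (chartK ac0 cp0).
Qed.

Lemma dform_row (c : chart R m M) (p : M) (u v : E) : atlas c -> cdom c p ->
  dform lam p u v = \sum_i \sum_j tcomp c p u 0 i * (tcomp c p v 0 j *
    ext_d (pullback (cinv c) lam) (cmap c p) (delta_mx 0 i) (delta_mx 0 j)).
Proof.
move=> ac cp; rewrite (dform_chart _ _ ac cp).
apply: (ext_d_row _ _ (chart_open_img ac) (cimg_cmap cp)).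
  by move=> y cy; exact: pullback_cinv_scalar.
by move=> e; exact: (pullback_cinv_smooth e ac 1).
Qed.

Lemma dformZ_l (p : M) k (u v : E) : dform lam p (k *: u) v = k * dform lam p u v.
Proof.
have ac0 := chart_at_atlas p; have cp0 := chart_at_dom p.
rewrite !(dform_row _ _ ac0 cp0) mulr_sumr; apply: eq_bigr => i _.
rewrite mulr_sumr; apply: eq_bigr => j _.
by rewrite (tcompZ k u ac0 cp0) mxE; apply: esym; exact: mulrA.
Qed.

Section PullbackOfForms.
Variables (V : normedModType R) (w : V -> M).
Hypothesis sw : smooth_map w.

Lemma preimage_dom_open (c : chart R m M) : atlas c -> open (w @^-1` cdom c).
Proof.
move=> ac; apply: open_comp; last exact: chart_open_dom.
by move=> z _; have [cw _] := sw; exact: cw.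
Qed.

Lemma pullback_smooth v : smooth_on setT (fun z => pullback w lam z v : R^o).
Proof.
move=> k; apply: Ck_local => z; exists (w @^-1` cdom (chart_at (w z))).
have ac := chart_at_atlas (w z); have oU := preimage_dom_open ac.
split=> //; first exact: chart_at_dom.
have [_ /(_ _ ac) sphi] := sw.
set c := chart_at (w z) in ac oU sphi *; set phi := cmap c \o w in sphi.
apply: (@Ck_ext _ _ _ _ _ (fun y => \sum_i 'D_v phi y 0 i *
  ((fun x => pullback (cinv c) lam x (delta_mx 0 i)) \o phi) y)) => //.
  move=> y cy; rewrite (pullback_chart lam v ac (smooth_chart_diff _ sw) cy).
  by rewrite [RHS]scalar_row//; apply: pullback_cinv_scalar => //; exact: cimg_cmap.
apply: Ck_sum => // i; apply: CkM => //.
  apply: (@Ck_coord _ _ _ _ _ ('D_v phi)) => //.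
  exact: (smooth_derive v sphi).
apply: (@Ck_comp _ _ _ _ _ (cimg c)) => //.
- exact: chart_open_img.
- by move=> y cy; exact: cimg_cmap.
- exact: pullback_cinv_smooth.
Qed.

(** Again [ext_d_pullback], now for [w] read in the preferred chart around [w z]. *)
Lemma ext_d_pullback_dform (z u v : V) :
  ext_d (pullback w lam) z u v = dform lam (w z) (dmap w z u) (dmap w z v).
Proof.
have ac := chart_at_atlas (w z); have oU := preimage_dom_open ac.
have [_ /(_ _ ac 2) Cphi] := sw.
have Uz : (w @^-1` cdom (chart_at (w z))) z by exact: chart_at_dom.
have UU' x : (w @^-1` cdom (chart_at (w z))) x ->
    cimg (chart_at (w z)) ((cmap (chart_at (w z)) \o w) x).
  by move=> cx; exact: cimg_cmap.
have lb y : cimg (chart_at (w z)) y -> scalar (pullback (cinv (chart_at (w z))) lam y).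
  exact: pullback_cinv_scalar.
have Cb e : Ck 1 (cimg (chart_at (w z)))
    (fun y => pullback (cinv (chart_at (w z))) lam y e : R^o).
  exact: (pullback_cinv_smooth e ac 1).
have aE x e : (w @^-1` cdom (chart_at (w z))) x ->
    pullback w lam x e = pullback (cinv (chart_at (w z))) lam
      ((cmap (chart_at (w z)) \o w) x) ('D_e (cmap (chart_at (w z)) \o w) x).
  by move=> cx; apply: pullback_chart => //; exact: smooth_chart_diff.
exact: (ext_d_pullback u v oU (chart_open_img ac) Uz UU' Cphi lb Cb aE).
Qed.

End PullbackOfForms.

End OneForms.

(** * Integral curves of a vector field on a manifold *)

Section IntegralCurves.
Context {R : realType} {m : nat} {M : manifold R m}.
Local Notation E := 'rV[R]_m.+1.
Implicit Types (X : M -> E) (g : R -> M).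

(** The pointwise content of [integral_curve], phrased through [chart_diff] so that the lemmas on
    change of charts apply. *)
Definition integral_at X g (s : R) : Prop :=
  chart_diff (g : R^o -> M) s /\ dmap (g : R^o -> M) s 1 = X (g s).

Lemma integral_curveP X I g : integral_curve X I g <->
  [/\ open I, is_interval I & forall s, I s -> integral_at X g s].
Proof.
split=> -[oI iI gI]; split=> // s Is.
  by have [cg [/derivable1_diffP dg gX]] := gI s Is.
have [[cg dg] gX] := gI s Is; split=> //; split=> //.
exact: diff_derivable.
Qed.

Lemma line_chart_diff (V : normedModType R) (f : V -> M) (x u : V) (s : R) :
  chart_diff f (x + s *: u) ->
  chart_diff (fun s : R^o => f (x + s *: u)) s /\
  dmap (fun s : R^o => f (x + s *: u)) s 1 = dmap f (x + s *: u) u.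
Proof.
move=> [cf df].
have dd : is_derive (x + s *: u) u (cmap (chart_at (f (x + s *: u))) \o f)
    (dmap f (x + s *: u) u).
  by split=> //; exact: diff_derivable.
have [d1 d2] := is_derive_line dd.
split; last exact: d2.
split; last exact/derivable1_diffP.
apply: (@continuous_comp _ _ _ (fun s : R^o => x + s *: u) f) => //.
by apply: cvgD; [exact: cvg_cst|exact: scalel_continuous].
Qed.

Lemma integral_shift X g (a s : R) : integral_at X g (a + s) ->
  integral_at X (fun s => g (a + s)) s.
Proof.
move=> [dg gX].
have s1 (t : R) : a + t *: (1 : R^o) = a + t by rewrite [_ *: _]mulr1.
have := @line_chart_diff R^o (g : R^o -> M) a (1 : R^o) s.
rewrite s1 (_ : (fun s : R^o => _) = (fun s => g (a + s))).
  by move=> /(_ dg)[H1 H2]; split; [exact: H1|exact: etrans H2 gX].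
by apply/funext => t; rewrite s1.
Qed.

Lemma integral_scale X g (k s : R) : integral_at X g (s * k) ->
  integral_at (fun p => k *: X p) (fun s => g (s * k)) s.
Proof.
move=> [dg gX].
have s1 (t : R) : 0 + t *: (k : R^o) = t * k by rewrite add0r.
have := @line_chart_diff R^o (g : R^o -> M) 0 (k : R^o) s.
rewrite s1 (_ : (fun s : R^o => _) = (fun s => g (s * k))); last first.
  by apply/funext => t; rewrite s1.
move=> /(_ dg)[H1 H2]; split; first exact: H1.
have k1 : k *: (1 : R^o) = k := mulr1 k.
have := dmapZ k (1 : R^o) dg; rewrite k1 gX; exact: etrans H2.
Qed.

Definition field_in_chart X (c : chart R m M) (x : E) : E :=
  tcomp c (cinv c x) (X (cinv c x)).

Lemma smooth_vector_fieldZ X k : smooth_vector_field X ->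
  smooth_vector_field (fun p => k *: X p).
Proof.
move=> sX c ac j; have oc := chart_open_img ac.
apply: (@Ck_ext _ _ _ _ _ (fun x => k *: field_in_chart X c x)) => //.
  by move=> x cx; have [cp _] := cimgP ac cx; rewrite tcompZ.
apply: Ck_row => // i; under eq_fun do rewrite mxE.
apply: CkM => //; first exact: Ck_cst.
by apply: Ck_coord => //; exact: sX.
Qed.

Section Chart.
Variables (X : M -> E) (c : chart R m M).
Hypothesis ac : atlas c.

Lemma integral_in_chart g (s : R) : integral_at X g s -> cdom c (g s) ->
  is_derive (s : R^o) (1 : R^o) (cmap c \o g : R^o -> E)
    (field_in_chart X c ((cmap c \o g) s)).
Proof.
move=> [dg gX] cs; split.
  by apply: diff_derivable; exact: (chart_diff_differentiable ac dg cs).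
by rewrite (derive_chart (1 : R^o) ac dg cs) gX /field_in_chart /= chartK.
Qed.

Lemma integral_of_chart (y : R -> E) (s : R) :
  cimg c (y s) ->
  is_derive (s : R^o) (1 : R^o) (y : R^o -> E) (field_in_chart X c (y s)) ->
  integral_at X (cinv c \o y) s.
Proof.
move=> cy dy; have cys := is_derive_continuous dy.
have [cp yE] := cimgP ac cy.
have cg : {for s, continuous ((cinv c \o y) : R^o -> M)}.
  by apply: continuous_comp => //; exact: cinv_continuous.
have near_y : \forall t \near (s : R^o), y t = (cmap c \o (cinv c \o y)) t.
  have : \forall t \near (s : R^o), cimg c (y t).
    by apply: cys; apply: open_nbhs_nbhs; split=> //; exact: chart_open_img.
  by apply: filterS => t ct /=; have [_ ->] := cimgP ac ct.
have [d1 d2] := near_eq_is_derive near_y dy.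
have dc : differentiable (cmap c \o (cinv c \o y) : R^o -> E) s.
  exact/derivable1_diffP.
have [H1 H2] := chart_change ac (chart_at_atlas _) cg cp (chart_at_dom _) dc.
split; first by split.
rewrite /dmap H2 d2 /field_in_chart /=.
set p := cinv c (y s) in cp yE *.
by rewrite -[RHS](dmap_tcomp (X p) ac cp) /dmap chartK.
Qed.

End Chart.

Lemma integral_local_uniqueness X g1 g2 (s0 : R) : smooth_vector_field X ->
  (\forall s \near (s0 : R^o), integral_at X g1 s) ->
  (\forall s \near (s0 : R^o), integral_at X g2 s) ->
  g1 s0 = g2 s0 -> \forall s \near (s0 : R^o), g1 s = g2 s.
Proof.
move=> sX I1 I2 E0.
pose c := chart_at (g1 s0); have ac : atlas c := chart_at_atlas _.
have c1 : cdom c (g1 s0) := chart_at_dom _.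
have c2 : cdom c (g2 s0) by rewrite -E0.
have [[cg1 _] _] := nbhs_singleton I1; have [[cg2 _] _] := nbhs_singleton I2.
have n1 := near_dom ac cg1 c1; have n2 := near_dom ac cg2 c2.
have := @ode_local_uniqueness R _ (cimg c) (field_in_chart X c) (cmap c \o g1)
  (cmap c \o g2) s0 (chart_open_img ac) (sX _ ac 1%N) (cimg_cmap c1).
rewrite /= E0 => /(_ erefl) H.
have {}H := H _.
have : \forall s \near (s0 : R^o), cmap c (g1 s) = cmap c (g2 s).
  apply: H; near=> s; split; apply: integral_in_chart => //.
  - by near: s.
  - by near: s.
  - by near: s.
  - by near: s.
move=> H1; near=> s.
rewrite -(@chartK _ _ _ c (g1 s) ac); last by near: s.
rewrite -(@chartK _ _ _ c (g2 s) ac); last by near: s.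
congr cinv; by near: s.
Unshelve. all: by end_near. Qed.

(** The set where the curves agree is open by local uniqueness and its complement in [I] is open
    because [M] is Hausdorff; [I] is connected. *)
Lemma integral_uniqueness X (I : set R) g1 g2 (a : R) : smooth_vector_field X ->
  open I -> is_interval I ->
  (forall s, I s -> integral_at X g1 s) -> (forall s, I s -> integral_at X g2 s) ->
  I a -> g1 a = g2 a -> forall s, I s -> g1 s = g2 s.
Proof.
move=> sX oI iI I1 I2 Ia E0 s Is.
pose B := [set t | I t /\ g1 t = g2 t].
have nI t : I t -> nbhs t I by move=> It; exact: open_nbhs_nbhs.
have oB : open B.
  rewrite openE => t [It gt].
  have n1 : \forall t \near (t : R^o), integral_at X g1 t by apply: filterS (nI _ It).
  have n2 : \forall t \near (t : R^o), integral_at X g2 t by apply: filterS (nI _ It).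
  have := integral_local_uniqueness sX n1 n2 gt.
  by apply: filterS2 (nI _ It) => u Iu gu; split.
have oC : open [set t | I t /\ g1 t <> g2 t].
  rewrite openE => t [It /eqP gt].
  have [[cg1 _] _] := I1 _ It; have [[cg2 _] _] := I2 _ It.
  have := @manifold_hausdorff _ _ M; rewrite open_hausdorff.
  move=> /(_ _ _ gt)[[U V] /= [U1 V2] [oU oV /eqP UV]].
  have n1 : nbhs t (g1 @^-1` U).
    by apply: cg1; apply: open_nbhs_nbhs; split=> //; exact: set_mem.
  have n2 : nbhs t (g2 @^-1` V).
    by apply: cg2; apply: open_nbhs_nbhs; split=> //; exact: set_mem.
  apply: filterS3 (nI _ It) n1 n2 => u Iu Uu Vu; split=> // gu.
  have : (set0 : set M) (g1 u) by rewrite -UV; split=> //; rewrite gu.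
  by [].
have /connected_intervalP cI := iI.
have : B = I; last by move=> BI; have [] : B s by rewrite BI.
apply: cI; first by exists a.
- by exists B => //; apply/seteqP; split=> [t [] //|t []].
- exists (~` [set t | I t /\ g1 t <> g2 t]); first exact: open_closedC.
  apply/seteqP; split=> [t [It gt]|t [It /= nt]]; split=> //=; first by case.
  by apply: contrapT => gt; apply: nt.
Qed.

Lemma integral_existence X (p : M) : smooth_vector_field X ->
  exists d g, [/\ 0 < d, g 0 = p & forall s : R, `|s| < d -> integral_at X g s].
Proof.
move=> sX; pose c := chart_at p; have ac : atlas c := chart_at_atlas _.
have cp : cdom c p := chart_at_dom _.
have [d [y [d0 y0] yP]] :=
  ode_local_existence (chart_open_img ac) (sX _ ac 1%N) (cimg_cmap cp).
exists d, (cinv c \o y); split=> //; first by rewrite /= y0 chartK.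
by move=> s /yP[cy dy]; exact: integral_of_chart.
Qed.

(** [I] is the union of the domains of all solutions through [p] at time 0. Two solutions agree on
    the intersection of their domains, an interval containing 0, so their values glue. *)
Lemma maximal_integral_curve X (p : M) : smooth_vector_field X ->
  exists I g, [/\ integral_curve X I g, I 0, g 0 = p &
    forall J h, integral_curve X J h -> J 0 -> h 0 = p ->
      J `<=` I /\ forall s, J s -> g s = h s].
Proof.
move=> sX.
pose sol (Jh : set R * (R -> M)) :=
  [/\ integral_curve X Jh.1 Jh.2, Jh.1 0 & Jh.2 0 = p].
pose I := [set s | exists2 Jh, sol Jh & Jh.1 s].
have /choice[g gP] (s : R) : exists q, I s ->
    exists2 Jh, sol Jh /\ Jh.1 s & Jh.2 s = q.
  have [[Jh sJh Js]|nI] := pselect (I s); last by exists p.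
  by exists (Jh.2 s) => _; exists Jh.
have agree Jh Jh' s : sol Jh -> sol Jh' -> Jh.1 s -> Jh'.1 s -> Jh.2 s = Jh'.2 s.
  case: Jh Jh' => [J h] [J' h'] [/= /integral_curveP[oJ iJ hJ] J0 h0].
  move=> [/= /integral_curveP[oJ' iJ' hJ'] J'0 h'0] Js J's.
  have oK : open (J `&` J') by exact: openI.
  have iK : is_interval (J `&` J').
    move=> x y [Jx J'x] [Jy J'y] z xzy.
    by split; [exact: iJ xzy|exact: iJ' xzy].
  have K0 : (J `&` J') 0 by [].
  apply: (integral_uniqueness sX oK iK _ _ K0) => //.
  - by move=> t [/hJ].
  - by move=> t [_ /hJ'].
  - by rewrite h0.
have gE Jh s : sol Jh -> Jh.1 s -> g s = Jh.2 s.
  move=> sJh Js; have Is : I s by exists Jh.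
  have [Jh' [sJh' J's] <-] := gP _ Is.
  exact: agree.
have [d [h [d0 h0 hd]]] := integral_existence p sX.
have soldh : sol ([set s | `|s| < d], h).
  split=> //=; last by rewrite normr0.
  apply/integral_curveP; split=> //.
    rewrite (_ : mkset _ = ball (0 : R) d); first exact: ball_open.
    by apply/seteqP; split=> t; rewrite /ball /= sub0r normrN.
  move=> x y /=; rewrite !ltr_norml => /andP[x1 x2] /andP[y1 y2] z /andP[xz zy].
  by rewrite /= ltr_norml; apply/andP; split; lra.
have maxP J h' : integral_curve X J h' -> J 0 -> h' 0 = p ->
    J `<=` I /\ forall s, J s -> g s = h' s.
  move=> iJ J0 h'0; have sJ : sol (J, h') by [].
  by split=> s Js; [exists (J, h')|exact: (gE (J, h'))].
exists I, g; split=> //; last 2 first.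
- by exists ([set s | `|s| < d], h) => //=; rewrite normr0.
- by rewrite (gE _ _ soldh) //= normr0.
apply/integral_curveP; split.
- rewrite openE => s [[J h'] sJ /= Js].
  have [/integral_curveP[oJ _ _] _ _] := sJ; rewrite /= in oJ.
  have : nbhs s J by exact: open_nbhs_nbhs.
  by apply: filterS => t Jt; exists (J, h').
(* The two ends may come from different solutions, but both domains contain 0: a [z >= 0] lies in
   the domain of the right end, a [z < 0] in that of the left one. *)
- move=> x y [[J h1] sJ /= Jx] [[K h2] sK /= Ky] z xzy.
  have [z0|z0] := leP 0 z.
    exists (K, h2) => //=; have [/integral_curveP[_ iK _] K0 _] := sK.
    have /andP[_] := xzy; rewrite le_eqVlt => /predU1P[->//|zy].
    have [->//|zn0] := eqVneq z 0.
    apply: (iK 0 y) => //; rewrite z0/=; exact: ltW.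
  exists (J, h1) => //=; have [/integral_curveP[_ iJ _] J0 _] := sJ.
  apply: (iJ x 0) => //; rewrite (ltW z0) andbT.
  by have /andP[] := xzy.
- move=> s [[J h'] sJ /= Js].
  have [/integral_curveP[oJ _ hJ] _ _] := sJ; rewrite /= in oJ hJ.
  have nE : \forall t \near (s : R^o), h' t = g t.
    have : nbhs s J by exact: open_nbhs_nbhs.
    by apply: filterS => t Jt; rewrite (gE (J, h')).
  have [[ch' dh'] h'X] := hJ _ Js.
  have gs : g s = h' s by rewrite (gE (J, h')).
  have nE' : \forall t \near (s : R^o), (cmap (chart_at (h' s)) \o h') t =
      (cmap (chart_at (h' s)) \o g) t.
    by apply: filterS nE => t /= ->.
  split; first split.
  + rewrite /prop_for /continuous_at gs; apply: cvg_trans ch'.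
    by apply: near_eq_cvg; apply: filterS nE.
  + by rewrite gs; exact: near_eq_differentiable nE' _.
  + by rewrite /dmap gs -(near_eq_derive _ nE').
Qed.

(** A curve joining [p] to [q] from time [a] to time [b], shifted to start at time 0, is absorbed by
    the maximal one, which thus reaches [q] at time [b - a]. *)
Lemma maximal_curve_trajectory X (p : M) I g : integral_curve X I g -> I 0 ->
  g 0 = p ->
  (forall J h, integral_curve X J h -> J 0 -> h 0 = p ->
    J `<=` I /\ forall s, J s -> g s = h s) ->
  g @` I = trajectory X p.
Proof.
move=> cI I0 g0 maxP; apply/seteqP; split=> [q [s Is <-]|q].
  by exists I, g, 0, s; split.
move=> [J [h [a [b [/integral_curveP[oJ iJ hJ] Ja Jb ha hb]]]]].
pose J' := [set s | J (a + s)].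
have [] := maxP J' (fun s => h (a + s)).
- apply/integral_curveP; split.
  + apply: open_comp => // s _.
    by apply: cvgD; [exact: cvg_cst|exact: cvg_id].
  + move=> x y Jx Jy z /andP[xz zy]; apply: (iJ _ _ Jx Jy).
    by rewrite !lerD2l xz zy.
  + by move=> s Js; apply: integral_shift; exact: hJ.
- by rewrite /J' /= addr0.
- by rewrite addr0.
move=> JI gE; exists (b - a); last by rewrite gE /J' /= subrKC.
by apply: JI; rewrite /J' /= subrKC.
Qed.

End IntegralCurves.

(** * Continuous nonnegative functions with zero integral *)

Section IntegralZero.
Context {R : realType}.
Import HBNNSimple.

(* The integral of a nonnegative function is the supremum of the integrals of
   the simple functions below it, one of which is [e] times the indicator of [B]. *)
Lemma ge0_integral_lower_bound d (T : measurableType d)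
    (mu : {measure set T -> \bar R}) (D B : set T) (f : T -> R) (e : R) :
  measurable B -> B `<=` D -> 0 <= e -> (forall x, D x -> 0 <= f x) ->
  (forall x, B x -> e <= f x) ->
  (e%:E * mu B <= \int[mu]_(x in D) (f x)%:E)%E.
Proof.
move=> mB BD e0 f0 fe.
have h0 : (forall x, D x -> 0 <= (f x)%:E)%E by move=> x Dx; rewrite lee_fin f0.
rewrite (ge0_integralE _ h0).
pose h := scale_nnsfun (indic_nnsfun R mB) e0.
have hE x : h x = e * (x \in B)%:R by [].
apply: ereal_sup_ubound; exists h.
  move=> x; rewrite (hE x) patchE; case: ifPn => Dx.
    rewrite lee_fin; case: (boolP (x \in B)) => Bx.
      by rewrite mulr1; apply: fe; exact: set_mem.
    by rewrite mulr0; apply: f0; exact: set_mem.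
  suff -> : x \in B = false by rewrite mulr0.
  apply/negP => /set_mem /BD Dx'; move: Dx; rewrite notin_setE; exact.
rewrite sintegralrM; congr (_ * _)%E.
exact: sintegral_indic.
Qed.

Lemma continuous_integral_eq0 (f : R^o * R^o -> R^o) :
  continuous f -> (forall z, 0 <= f z :> R) ->
  (\int[(@lebesgue_measure R \x @lebesgue_measure R)%E]_(z in
     (setT `*` `[0%R, 1%R[)) (f (z.1, z.2))%:E = 0)%E ->
  forall a b : R, 0 <= b < 1 -> f (a, b) = 0.
Proof.
move=> cf f0 If a b /andP[b0 b1].
apply/eqP; rewrite eq_le f0 andbT leNgt; apply/negP => fpos.
pose e := f (a, b) / 2.
have e0 : 0 < e by rewrite divr_gt0.
have /nbhs_ballP[r /= r0 rP] : \forall z \near (a, b), e <= f z :> R.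
  have /cvgrPdist_lt/(_ _ e0) := cf (a, b).
  apply: filterS => z; rewrite ltr_distlC => /andP[/ltW + _].
  by apply: le_trans; rewrite lerBrDr -splitr.
(* The square is placed to the upper right of (a, b), since [b] may be 0; halving [r] puts the
   closed square inside the open ball, and halving [1 - b] keeps it below t = 1. *)
pose d := Num.min (r / 2) ((1 - b) / 2).
have d0 : 0 < d by rewrite lt_min !divr_gt0// subr_gt0.
have dr : d < r by rewrite gt_min ltr_pdivrMr// ltr_pMr// ltr1n.
have db : b + d < 1.
  rewrite -ltrBrDl gt_min; apply/orP; right.
  by rewrite ltr_pdivrMr// ltr_pMr ?subr_gt0// ltr1n.
pose B : set (R * R) := `[a, a + d] `*` `[b, b + d].
have ia t x : x \in `[t, t + d] -> ball t r x.
  rewrite in_itv /= => /andP[t1 t2]; rewrite /ball /= distrC ger0_norm ?subr_ge0//.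
  by rewrite ltrBlDl (le_lt_trans t2)// ltrD2l.
have mB : measurable B by exact: measurableX.
have BD : B `<=` setT `*` `[0%R, 1%R[.
  move=> [x y] [/= _ yB]; split=> //=; move: yB; rewrite /= !in_itv /=.
  by move=> /andP[y1 y2]; rewrite (le_trans b0 y1) (le_lt_trans y2).
have fB z : B z -> e <= f (z.1, z.2) :> R.
  by case: z => x y [/= xB yB]; apply: rP; split; exact: ia.
have := @ge0_integral_lower_bound _ _ (lebesgue_measure \x lebesgue_measure)%E
  (setT `*` `[0%R, 1%R[) B (fun z => f (z.1, z.2)) e mB BD (ltW e0) (fun z _ => f0 _) fB.
have muB : (@lebesgue_measure R \x @lebesgue_measure R)%E B = (d%:E * d%:E)%E.
  rewrite /B product_measure1E//= !lebesgue_measure_itv /= !lte_fin !ltrDl d0.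
  by rewrite -!EFinB !(addrC _ d) !addrK.
rewrite If => H; have : (e%:E * (d%:E * d%:E) <= 0)%E by rewrite -muB; exact: H.
by rewrite -!EFinM lee_fin leNgt => /negP; apply; rewrite !mulr_gt0.
Qed.

End IntegralZero.

(** * Vanishing of the contact part of the differential *)

Section MasslessInstantons.
Context {R : realType} {n : nat} {M : manifold R n.*2}.
Local Notation E := 'rV[R]_(n.*2).+1.
Local Notation plane := (R^o * R^o)%type.
Local Notation dtau := (@d_tau R).
Local Notation dt := (@d_t R).
Variables (lam : M -> E -> R) (X : M -> E) (J : M -> E -> E) (w : plane -> M).
Hypothesis triad : contact_triad lam X J.
Hypothesis sw : smooth_cylinder_map w.

Let smooth_w : smooth_map w. Proof. by case: sw. Qed.
Let smooth_lam : smooth_one_form lam. Proof. by case: triad => [[]]. Qed.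
Let scalar_lam p : scalar (lam p). Proof. by case: smooth_lam. Qed.
Let smooth_X : smooth_vector_field X. Proof. by case: triad => _ []. Qed.
Let lamX p : lam p (X p) = 1. Proof. by case: triad => _ []. Qed.
Let dformX p v : dform lam p (X p) v = 0. Proof. by case: triad => _ []. Qed.
Let linear_J p : linear (J p). Proof. by case: triad => _ _ [[]]. Qed.

Lemma lam_pi_xi p v : lam p (pi_xi lam X p v) = 0.
Proof.
by rewrite /pi_xi -scaleNr (scalar_funD _ _ (scalar_lam p)) (scalar_funZ _ _ (scalar_lam p)) lamX mulr1 subrr.
Qed.

Lemma g_xi0 p : g_xi lam J p 0 0 = 0.
Proof. by rewrite /g_xi -[X in dform _ _ X](scale0r 0) dformZ_l// mul0r. Qed.

Lemma g_xi_ge0 p v : lam p v = 0 -> 0 <= g_xi lam J p v v.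
Proof.
move=> lv; have [->|v0] := eqVneq v 0; first by rewrite g_xi0.
by apply: ltW; case: triad => _ _ [_ _ _ _]; apply.
Qed.

Lemma g_xi_eq0 p v : lam p v = 0 -> g_xi lam J p v v = 0 -> v = 0.
Proof.
move=> lv gv; apply/eqP; apply: contraT => v0.
case: triad => _ _ [_ _ _ _] /(_ p v lv v0).
by rewrite gv ltxx.
Qed.

Lemma dpi_norm2_ge0 z : 0 <= dpi_norm2 lam X J w z.
Proof. by rewrite addr_ge0// g_xi_ge0// lam_pi_xi. Qed.

Lemma dpi_tcomp (c : chart R _ M) z v : atlas c -> cdom c (w z) ->
  tcomp c (w z) (dpi lam X w z v) = 'D_v (cmap c \o w) z -
    pullback w lam z v *: field_in_chart X c (cmap c (w z)).
Proof.
move=> ac cz; rewrite /dpi /pi_xi -scaleNr tcompD// tcompZ// scaleNr.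
by rewrite (derive_chart v ac (smooth_chart_diff z smooth_w) cz) /field_in_chart chartK.
Qed.

Definition J_in_chart (c : chart R _ M) (e x : E) : E :=
  tcomp c (cinv c x) (J (cinv c x) (dmap (cinv c) x e)).

(** In coordinates [J] is a matrix, and the rows [J_in_chart c (delta_mx 0 k)] are the functions
    declared smooth by [smooth_endomorphism]. *)
Lemma J_tcomp (c : chart R _ M) p u : atlas c -> cdom c p ->
  tcomp c p (J p u) =
  \sum_k tcomp c p u 0 k *: J_in_chart c (delta_mx 0 k) (cmap c p).
Proof.
move=> ac cp; set x := cmap c p.
have cx : cimg c x by exact: cimg_cmap.
have px : cinv c x = p by exact: chartK.
have dc := cinv_chart_diff ac cx.
pose f e := J_in_chart c e x.
have fE : tcomp c p (J p u) = f (tcomp c p u).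
  by rewrite /f /J_in_chart px dmap_tcomp.
have cpx : cdom c (cinv c x) by rewrite px.
have fZD k a b : f (k *: a + b) = k *: f a + f b.
  rewrite /f /J_in_chart (dmapD (k *: a) b dc) (dmapZ k a dc).
  move: (dmap (cinv c) x a) (dmap (cinv c) x b) => a' b'.
  by rewrite linear_J (tcompD _ _ ac cpx) (tcompZ _ _ ac cpx).
have f0 : f 0 = 0 by have := fZD (-1) 0 0; rewrite scaler0 addr0 scaleN1r addNr.
rewrite fE {1}(row_sum_delta (tcomp c p u)).
by elim/big_rec2: _ => [//|i y1 y2 _ <-]; rewrite fZD.
Qed.

(** In a fixed chart the density is a polynomial in the first derivatives of [w], the components of
    its pullback, and the coefficients of [X], [J] and d lam along [w], all of which are
    continuous. *)
Lemma dpi_norm2_continuous : continuous (dpi_norm2 lam X J w : plane -> R^o).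
Proof.
move=> z0; pose c := chart_at (w z0).
have ac : atlas c := chart_at_atlas _.
pose U := w @^-1` cdom c; have oU : open U by exact: preimage_dom_open.
have oc := chart_open_img ac.
have [_ /(_ _ ac) sphi] := smooth_w.
set phi := cmap c \o w in sphi.
have Uphi z : U z -> cimg c (phi z) by move=> cz; exact: cimg_cmap.
pose P v z : E := 'D_v phi z - pullback w lam z v *: field_in_chart X c (phi z).
pose N v z : E := \sum_k P v z 0 k *: J_in_chart c (delta_mx 0 k) (phi z).
pose om i j (x : E) : R^o :=
  ext_d (pullback (cinv c) lam) x (delta_mx 0 i) (delta_mx 0 j).
pose G v z : R^o := \sum_i \sum_j P v z 0 i * (N v z 0 j * om i j (phi z)).
have C0comp (g : E -> R^o) : Ck 0 (cimg c) g -> Ck 0 U (g \o phi).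
  by move=> Cg; apply: (Ck_comp oU oc Uphi _ Cg); exact: (sphi 0).
have CP v i : Ck 0 U (fun z => P v z 0 i : R^o).
  apply: (@Ck_ext _ _ _ _ _ (fun z => 'D_v phi z 0 i +
    -1 * (pullback w lam z v * (fun x => field_in_chart X c x 0 i) (phi z)))) => //.
    by move=> z _; rewrite /P !mxE mulN1r.
  apply: CkD => //.
    by apply: (@Ck_coord _ _ _ _ _ ('D_v phi)) => //; exact: (smooth_derive v sphi).
  apply: CkM => //; first exact: Ck_cst.
  apply: CkM => //.
    exact: (Ck_sub (@subsetT _ U) (pullback_smooth smooth_lam smooth_w v 0)).
  exact: (C0comp _ (Ck_coord i oc (smooth_X ac 0))).
have CN v j : Ck 0 U (fun z => N v z 0 j : R^o).
  apply: (@Ck_ext _ _ _ _ _ (fun z => \sum_k P v z 0 k *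
    (fun x => J_in_chart c (delta_mx 0 k) x 0 j) (phi z))) => //.
    by move=> z _; rewrite /N summxE; apply: eq_bigr => k _; rewrite [RHS]mxE.
  apply: Ck_sum => // k; apply: CkM => //.
  have [_ _ [[_ sJ] _ _ _ _]] := triad.
  exact: (C0comp _ (Ck_coord j oc (sJ c ac (delta_mx 0 k) 0))).
have Com i j : Ck 0 (cimg c) (om i j).
  apply: (@Ck_ext _ _ _ _ _ (fun x =>
    'D_(delta_mx 0 i) (fun y => pullback (cinv c) lam y (delta_mx 0 j) : R^o) x +
    -1 * 'D_(delta_mx 0 j) (fun y => pullback (cinv c) lam y (delta_mx 0 i) : R^o) x)) => //.
    by move=> x _; rewrite /om /ext_d mulN1r.
  have [_ S1] := pullback_cinv_smooth smooth_lam (delta_mx 0 j) ac 1.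
  have [_ S2] := pullback_cinv_smooth smooth_lam (delta_mx 0 i) ac 1.
  apply: CkD => //; first exact: S1.
  by apply: CkM => //; [exact: Ck_cst|exact: S2].
have CG v : Ck 0 U (G v).
  apply: Ck_sum => // i; apply: Ck_sum => // j.
  by apply: CkM => //; apply: CkM => //; exact: C0comp.
have GE v z : U z -> g_xi lam J (w z) (dpi lam X w z v) (dpi lam X w z v) = G v z.
  move=> cz; rewrite /g_xi (dform_row smooth_lam _ _ ac cz).
  apply: eq_bigr => i _; apply: eq_bigr => j _.
  by rewrite (J_tcomp _ ac cz) (dpi_tcomp v ac cz).
have C : Ck 0 U (dpi_norm2 lam X J w : plane -> R^o).
  apply: (@Ck_ext _ _ _ _ _ (fun z => G dtau z + G dt z)) => //.
    by move=> z cz; exact: esym (congr2 +%R (GE dtau z cz) (GE dt z cz)).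
  exact: CkD.
apply: C; exact: chart_at_dom.
Qed.

Lemma cylinder_map_periodic z : w (z + dt) = w z.
Proof.
case: sw => _ pw; case: z => a b.
by rewrite [(a, b) + dt](_ : _ = (a, b + 1)) ?pw//; congr pair; rewrite /= addr0.
Qed.

Lemma dmap_periodic z v : dmap w (z + dt) v = dmap w z v.
Proof.
rewrite /dmap cylinder_map_periodic; apply: derive_periodic => y /=.
by rewrite cylinder_map_periodic.
Qed.

Lemma dpi_eq0 : massless lam X J w -> forall z v, dpi lam X w z v = 0.
Proof.
rewrite /massless /pi_energy => E0.
have {}E0 : (\int[(@lebesgue_measure R \x @lebesgue_measure R)%E]_(z in
     (setT `*` `[0%R, 1%R[)) (dpi_norm2 lam X J w (z.1, z.2))%:E = 0)%E.
  by have /eqP := E0; rewrite mule_eq0 eqe invr_eq0 pnatr_eq0/= => /eqP.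
have N0 := continuous_integral_eq0 dpi_norm2_continuous dpi_norm2_ge0 E0.
have dpiL (z u v : plane) (k l : R) :
    dpi lam X w z (k *: u + l *: v) = k *: dpi lam X w z u + l *: dpi lam X w z v.
  have dw := smooth_chart_diff z smooth_w.
  have lz := scalar_lam (w z).
  rewrite /dpi /pi_xi (dmapD (k *: u) (l *: v) dw) (dmapZ k u dw) (dmapZ l v dw).
  move: (dmap w z u) (dmap w z v) => a b.
  rewrite (scalar_funD _ _ lz) (scalar_funZ k a lz) (scalar_funZ l b lz).
  by apply/rowP => i; rewrite !mxE; ring.
have dpi0 (z v : plane) : dpi_norm2 lam X J w z = 0 -> dpi lam X w z v = 0.
  move=> /eqP; rewrite /dpi_norm2 paddr_eq0 ?g_xi_ge0 ?lam_pi_xi// => /andP[/eqP e1 /eqP e2].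
  have d1 : dpi lam X w z dtau = 0 := g_xi_eq0 (lam_pi_xi _ _) e1.
  have d2 : dpi lam X w z dt = 0 := g_xi_eq0 (lam_pi_xi _ _) e2.
  by rewrite (plane_decomp v) dpiL d1 d2 !scaler0 addr0.
have dpiP (z v : plane) : dpi lam X w (z + dt) v = dpi lam X w z v.
  by rewrite /dpi dmap_periodic cylinder_map_periodic.
have dpiPn (k : nat) (z v : plane) : dpi lam X w (z + k%:R *: dt) v = dpi lam X w z v.
  elim: k z => [|k IH] z; first by rewrite scale0r addr0.
  by rewrite -natr1 scalerDl scale1r addrA dpiP IH.
have shift (a b : R) (k : nat) : (a, b) + k%:R *: dt = (a, b + k%:R) :> plane.
  by congr pair; rewrite /= ?[_ *: _]mulr1// [_ *: _]mulr0 addr0.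
have nonneg (a b : R) v : 0 <= b -> dpi lam X w (a, b) v = 0.
  move=> b0; have /andP[k1 k2] := truncn_itv b0.
  rewrite -[b](subrK (Num.truncn b)%:R) -shift dpiPn; apply: dpi0; apply: N0.
  by rewrite subr_ge0 k1/= ltrBlDl -[X in _ < X]natr1 in k2 *.
(* Periods are only added: a nonnegative [b] is its fractional part plus an integer, and a negative
   [b] is first raised above 0. *)
move=> [a b] v; have [b0|b0] := leP 0 b; first exact: nonneg.
rewrite -(dpiPn (Num.bound (- b))) shift; apply: nonneg.
by rewrite -lerBlDl sub0r ltW// archi_boundP// oppr_ge0 ltW.
Qed.


End MasslessInstantons.

(** * Constancy of the pulled-back form and the shape of the instanton *)

Section ConstantPullback.
Context {R : realType} {n : nat} {M : manifold R n.*2}.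
Local Notation E := 'rV[R]_(n.*2).+1.
Local Notation plane := (R^o * R^o)%type.
Local Notation dtau := (@d_tau R).
Local Notation dt := (@d_t R).

Lemma pullback_cst (lam : M -> E -> R) (X : M -> E) (J : M -> E -> E)
    (w : plane -> M) :
  contact_triad lam X J -> contact_instanton lam X J w ->
  bounded_gradient lam X J w -> massless lam X J w ->
  exists A B : R, forall z v,
    pullback w lam z v = v.1 * A + v.2 * B /\
    dmap w z v = (v.1 * A + v.2 * B) *: X (w z).
Proof.
move=> triad [sw _ coclosed] [C gradC] E0.
have [[smooth_lam _ _] [_ lamX dformX] _] := triad.
have [smooth_w _] := sw.
have dpi0 := dpi_eq0 triad sw E0.
have dwE z v : dmap w z v = pullback w lam z v *: X (w z).
  by have /eqP := dpi0 z v; rewrite subr_eq0 => /eqP.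
have pL z : scalar (pullback w lam z).
  by apply: pullback_scalar => //; exact: smooth_chart_diff.
pose p (z : plane) : R^o := pullback w lam z dtau.
pose q (z : plane) : R^o := pullback w lam z dt.
have per v z : pullback w lam (z + dt) v = pullback w lam z v.
  by rewrite /pullback (dmap_periodic sw) (cylinder_map_periodic sw).
have bnd z : p z ^+ 2 + q z ^+ 2 <= C :> R.
  have pi0 v : pi_xi lam X (w z) (dmap w z v) = 0 := dpi0 z v.
  have normE v : triad_metric lam X J (w z) (dmap w z v) (dmap w z v) =
      0 + pullback w lam z v * pullback w lam z v :=
    congr2 +%R (etrans (congr2 (g_xi lam J (w z)) (pi0 v) (pi0 v)) (g_xi0 triad _)) erefl.
  have E : dw_norm2 lam X J w z = (0 + p z * p z) + (0 + q z * q z) :=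
    congr2 +%R (normE dtau) (normE dt).
  have := gradC z; rewrite E.
  by move: (p z : R) (q z : R) => a b; rewrite !add0r !expr2.
have C0 : 0 <= C.
  by apply: le_trans (bnd 0); rewrite addr_ge0// sqr_ge0.
(* A bound without square roots: either |x| <= 1, or |x| <= x^2 <= C. *)
have sqb (x : R) : x ^+ 2 <= C -> `|x| <= C + 1.
  move=> xC; have [x1|x1] := leP `|x| 1; first by rewrite (le_trans x1)// lerDr.
  have : `|x| <= `|x| ^+ 2 by rewrite expr2 ler_peMl// ltW.
  by rewrite real_normK ?num_real// => /le_trans/(_ xC) /le_trans; apply; rewrite lerDl.
have pB z : `|p z : R| <= C + 1.
  by apply: sqb; apply: le_trans (bnd z); rewrite lerDl sqr_ge0.
have qB z : `|q z : R| <= C + 1.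
  by apply: sqb; apply: le_trans (bnd z); rewrite lerDr sqr_ge0.
have sub0 (a b : R) : a - b = 0 -> b = a by move/subr0_eq.
(* Both vectors fed to d lam are multiples of the Reeb field, which d lam annihilates. *)
have closed z : 'D_dt p z = 'D_dtau q z.
  have H : ext_d (pullback w lam) z dtau dt = 0.
    rewrite (ext_d_pullback_dform smooth_lam smooth_w) !dwE.
    by rewrite (dformZ_l smooth_lam) dformX mulr0.
  exact: (sub0 _ _ H).
have sp : smooth_on setT p by exact: pullback_smooth.
have sq : smooth_on setT q by exact: pullback_smooth.
(* Since j d/dtau = d/dt and j d/dt = -d/dtau, the form w^*lambda o j has components (q, -p); its
   closedness is the second Cauchy-Riemann equation. *)
have jt : (fun y => pullback_j lam w y dt : R^o) = - p.
  apply/funext => y; rewrite /pullback_j.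
  have -> : j_std dt = (-1) *: dtau :> plane.
    by rewrite /j_std /d_t /d_tau /=; congr pair; rewrite /= ?[_ *: _]mulr1// [_ *: _]mulr0.
  by rewrite (scalar_funZ _ _ (pL y)) mulN1r.
have jtau : (fun y => pullback_j lam w y dtau : R^o) = q.
  by apply/funext => y; rewrite /pullback_j /j_std /= oppr0.
have alg (a b r s : R) : a - b = 0 -> a = - r -> b = s -> r = - s.
  by move=> /subr0_eq -> -> <-; rewrite opprK.
have coclosed' z : 'D_dtau p z = - 'D_dt q z.
  have Np : 'D_dtau (- p) z = - 'D_dtau p z.
    by apply: deriveN; case: (smooth_is_derive z dtau sp).
  exact: (alg _ _ _ _ (coclosed z dtau dt)
    (etrans (congr1 (fun f : plane -> R^o => 'D_dtau f z) jt) Np)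
    (congr1 (fun f : plane -> R^o => 'D_dt f z) jtau)).
have [pE qE] := bounded_cauchy_riemann_cst sp sq (per dtau) (per dt) pB qB
  closed coclosed'.
exists (p 0), (q 0) => z v.
have E1 : pullback w lam z v = v.1 * p 0 + v.2 * q 0.
  rewrite {1}(plane_decomp v) (scalar_funD _ _ (pL z)).
  rewrite (scalar_funZ _ _ (pL z)) (scalar_funZ _ _ (pL z)).
  by rewrite -(pE z) -(qE z).
by split; [exact: E1|exact: etrans (dwE z v) (congr1 (fun r => r *: X (w z)) E1)].
Qed.

Lemma Rintegral_itv01_cst (r : R) :
  (\int[lebesgue_measure]_(t in `[0%R, 1%R[) r)%R = r.
Proof.
rewrite /Rintegral integral_cst//= lebesgue_measure_itv /= lte_fin ltr01.
by rewrite oppr0 adde0 mule1.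
Qed.

Lemma instanton_charge (lam : M -> E -> R) (w : plane -> M) (A B : R) :
  (forall z v, pullback w lam z v = v.1 * A + v.2 * B) ->
  contact_charge lam w = - A.
Proof.
move=> pE; rewrite /contact_charge.
under eq_Rintegral do rewrite /pullback_j pE /j_std /= mul0r addr0 mulN1r.
exact: Rintegral_itv01_cst.
Qed.

Lemma instanton_action (lam : M -> E -> R) (X : M -> E) (J : M -> E -> E)
    (w : plane -> M) (A B : R) :
  (forall z, dpi_norm2 lam X J w z = 0) ->
  (forall z v, pullback w lam z v = v.1 * A + v.2 * B) ->
  contact_action lam X J w = B.
Proof.
move=> N0 pE; rewrite /contact_action /pi_energy.
under eq_integral do rewrite N0.
rewrite integral0 mule0 /= add0r.
under eq_Rintegral do rewrite pE /d_t /= mul0r add0r mul1r.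
exact: Rintegral_itv01_cst.
Qed.

Lemma cst_pullback_factors (X : M -> E) (w : plane -> M) (A B : R) :
  smooth_vector_field X -> smooth_map w ->
  (forall z v, dmap w z v = (v.1 * A + v.2 * B) *: X (w z)) ->
  exists I gamma, [/\ integral_curve X I gamma,
    gamma @` I = trajectory X (w 0),
    forall v, I (v.1 * A + v.2 * B) /\ w v = gamma (v.1 * A + v.2 * B) &
    A != 0 \/ B != 0 -> I = setT].
Proof.
move=> sX sw dwE.
have [I [g [cI I0 g0 maxP]]] := maximal_integral_curve (w 0) sX.
pose k (v : plane) := v.1 * A + v.2 * B.
have kZ s v : k (s *: v) = s * k v.
  by rewrite /k mulrDr !mulrA.
have line v s : integral_at (fun p => k v *: X p) (fun s => w (0 + s *: v)) s.
  have [H1 H2] := line_chart_diff (smooth_chart_diff (0 + s *: v) sw).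
  by split; [exact: H1|exact: (etrans H2 (dwE (0 + s *: v) v))].
have oT : open (setT : set R) by exact: openT.
have iT : is_interval (setT : set R) by [].
(* When [k v = 1] the whole line s |-> w(s v) is an integral curve of [X], so maximality makes [I]
   everything. *)
have full v : k v = 1 -> I = setT.
  move=> kv; have [] := maxP setT (fun s => w (0 + s *: v)).
  - apply/integral_curveP; split=> // s _.
    by have := line v s; rewrite kv (_ : (fun p => 1 *: X p) = X)//;
      apply/funext => p; rewrite scale1r.
  - by [].
  - by rewrite scale0r addr0.
  - by move=> TI _; apply/seteqP; split.
(* If [k v = 0] only time 0 is needed; otherwise rescaling [v] brings [k] to 1. So [I] contains the
   needed times even when [A = B = 0]. *)
have Ik v s : I (s * k v).
  have [->|kv] := eqVneq (k v) 0; first by rewrite mulr0.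
  by rewrite (full ((k v)^-1 *: v)) ?kZ ?mulVf.
have [_ _ gI] := (integral_curveP _ _ _).1 cI.
exists I, g; split=> //; first exact: maximal_curve_trajectory.
- move=> v; split; first by rewrite -[X in I X]mul1r; exact: Ik.
  have H1 s : setT s -> integral_at (fun p => k v *: X p) (fun s => w (0 + s *: v)) s.
    by move=> _; exact: line.
  have H2 s : setT s -> integral_at (fun p => k v *: X p) (fun s => g (s * k v)) s.
    by move=> _; apply: integral_scale; apply: gI; exact: Ik.
  have H0 : w (0 + 0 *: v) = g (0 * k v) by rewrite scale0r addr0 mul0r g0.
  have := integral_uniqueness (smooth_vector_fieldZ (k v) sX) oT iT H1 H2
    (Logic.I : setT 0) H0 (Logic.I : setT 1).
  by rewrite scale1r add0r mul1r.
- have scE (r s : R) : r *: (s : R^o) = r * s by [].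
  case=> [A0|B0].
    apply: (full (A^-1, 0)); by rewrite /k /= mulVf// mul0r addr0.
  by apply: (full (0, B^-1)); rewrite /k /= mulVf// mul0r add0r.
Qed.

Lemma massless_instanton_orbit (lam : M -> E -> R) (X : M -> E) (J : M -> E -> E)
    (w : plane -> M) (T Q : R) :
  contact_triad lam X J -> contact_instanton lam X J w ->
  bounded_gradient lam X J w -> massless lam X J w ->
  T = contact_action lam X J w -> Q = contact_charge lam w ->
  exists (L : set M) (I : set R) (gamma : R -> M),
    [/\ factors_through X w Q T L I gamma,
        T != 0 -> I = setT /\ closed_orbit X T gamma,
        T != 0 -> Q = 0 ->
          forall s tau t : R, w (tau + s, t) = w (tau, t) &
        T = 0 -> Q != 0 ->
          exists c : R -> M, immersion c /\ range c = L].
Proof.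
move=> triad instw bw mw TE QE.
have [A [B pwE]] := pullback_cst triad instw bw mw.
have [smooth_cyl _ _] := instw; have [smooth_w pw] := smooth_cyl.
have [[smooth_lam _ _] [smooth_X lamX _] _] := triad.
have pE z v : pullback w lam z v = v.1 * A + v.2 * B by have [] := pwE z v.
have dwE z v : dmap w z v = (v.1 * A + v.2 * B) *: X (w z) by have [] := pwE z v.
have N0 z : dpi_norm2 lam X J w z = 0.
  have d0 v : dpi lam X w z v = 0 := dpi_eq0 triad smooth_cyl mw z v.
  by rewrite /dpi_norm2 !d0 (g_xi0 triad) addr0.
have QA : - Q = A by rewrite QE (instanton_charge pE) opprK.
have TB : T = B by rewrite TE (instanton_action N0 pE).
have [I [g [cI gI wg full]]] := cst_pullback_factors smooth_X smooth_w dwE.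
have w_g (tau t : R) : w (tau, t) = g (- Q * tau + T * t).
  by have [_ ->] := wg (tau, t); rewrite /= QA TB (mulrC A) (mulrC B).
exists (trajectory X (w 0)), I, g; split.
- split=> //; first by exists (w 0).
  move=> tau t; split=> //.
  by have [+ _] := wg (tau, t); rewrite /= QA TB (mulrC A) (mulrC B).
- move=> T0; have IT : I = setT by apply: full; right; rewrite -TB.
  split=> //; split; first by rewrite -IT.
  (* Every s is T (s / T), so gamma(s) = w(0, s / T), and a unit step in t is a step of T for
     gamma. *)
  move=> s; have sE : s = T * (s / T) by rewrite mulrC mulfVK.
  have wT t : w (0, t) = g (T * t) by rewrite w_g mulr0 add0r.
  have -> : s + T = T * (s / T + 1) by rewrite mulrDr mulr1 -sE.
  by rewrite -wT pw wT -sE.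
- by move=> T0 Q0 s tau t; rewrite !w_g Q0 oppr0 !mul0r.
- move=> T0 Q0; exists g.
  have IT : I = setT by apply: full; left; rewrite -QA oppr_eq0.
  split; last by rewrite -gI IT.
  (* Here T = 0, so gamma(s) = w(-s / Q, 0) inherits smoothness from [w]; its velocity is the Reeb
     field, nonzero because lambda is 1 on it. *)
  pose v0 : plane := ((- Q)^-1, 0).
  have gE : g = (fun s : R^o => w (s *: v0)).
    apply/funext => s; rewrite [s *: v0](_ : _ = (s * (- Q)^-1, 0)).
      by rewrite w_g mulr0 addr0 mulrC mulfVK// oppr_eq0.
    by congr pair; exact: mulr0.
  have [cw sw] := smooth_w.
  split.
    rewrite gE; split.
      move=> s; apply: (@continuous_comp _ _ _ (fun s : R^o => s *: v0) w).
        exact: scalel_continuous.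
      exact: cw.
    move=> c ac k; apply: (@Ck_line _ _ _ _ (w @^-1` cdom c) (cmap c \o w)).
      exact: preimage_dom_open.
    exact: sw.
  move=> s; have [_ _ gX] := (integral_curveP _ _ _).1 cI.
  have [_ ->] : integral_at X g s by apply: gX; rewrite IT.
  apply/eqP => X0; have := lamX (g s); rewrite X0 (scalar_fun0 _).
    by move=> /eqP; rewrite eq_sym oner_eq0.
  by case: smooth_lam.
Qed.

End ConstantPullback.

(** * Standard contact space and a Reeb leaf that is not closed *)

Section StandardContactSpace.
Context {R : realType}.

Lemma Ck_id (V : normedModType R) k (U : set V) : Ck k U id.
Proof.
case: k => [|k]; first by move=> x _; exact: cvg_id.
split=> [x _|v]; first by case: (is_diff_id x).
rewrite (_ : (fun x => _) = (fun=> v)); first exact: Ck_cst.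
by apply/funext => x; exact: derive_id.
Qed.

Lemma derive_affine (V W : normedModType R) (f : V -> W) (x u : V) (l : W) :
  (forall h : R, f (h *: u + x) - f x = h *: l) -> 'D_u f x = l.
Proof.
move=> fl; apply: lim_near_cst => //; rewrite near_withinE.
by apply: nearW => h h0 /=; rewrite fl scalerA mulVf// scale1r.
Qed.

(** A countable basis is given by the balls with rational centres and radii 1 / (k + 1). *)
Lemma second_countable_row m : @second_countable 'rV[R]_m.
Proof.
pose c (q : 'rV[rat]_m) : 'rV[R]_m := \row_i ratr (q 0 i).
pose b (qk : 'rV[rat]_m * nat) : set 'rV[R]_m := ball (c qk.1) (qk.2.+1%:R^-1).
exists (range b).
  apply: card_le_trans (card_image_le _ _) _; exact: countableP.
split=> [_ [qk _ <-]|x V]; first exact: ball_open.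
move=> /nbhs_ballP[e /= e0 eV].
have [k _ ke] : exists2 k, True & k.+1%:R^-1 < e / 2 :> R.
  have [//|k] := @ltr_add_invr R 0 (e / 2) _; first by rewrite divr_gt0.
  by rewrite add0r => ke; exists k.
have k0 : 0 < k.+1%:R^-1 :> R by rewrite invr_gt0.
have /choice[q qP] (i : 'I_m) : exists r : rat,
    `|x 0 i - ratr r| <= k.+1%:R^-1 / 2.
  have h0 : 0 < k.+1%:R^-1 / 2 :> R by rewrite divr_gt0.
  have rin : x 0 i - k.+1%:R^-1 / 2 < x 0 i + k.+1%:R^-1 / 2.
    by rewrite ltrD2l gt0_cp.
  have [r] := rat_in_itvoo rin; rewrite in_itv /= -ltr_distl distrC => /ltW.
  by exists r.
have xq : ball (c (\row_i q i)) (k.+1%:R^-1) x.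
  rewrite -ball_normE /ball_ /= distrC.
  apply: (@le_lt_trans _ _ (k.+1%:R^-1 / 2)).
    apply/row_norm_le => [|i]; first by rewrite divr_ge0// ltW.
    by rewrite !mxE.
  by rewrite ltr_pdivrMr// ltr_pMr// ltr1n.
exists (b (\row_i q i, k)); first by split=> //; exists (\row_i q i, k).
move=> y yq; apply: eV; rewrite [e]splitr.
apply: (@ball_triangle _ _ (c (\row_i q i))).
  by apply: ball_sym; apply: le_ball xq; exact: ltW.
by apply: le_ball yq; exact: ltW.
Qed.

Variable n : nat.
Local Notation E := 'rV[R]_(n.*2).+1.

Definition id_chart : chart R n.*2 E :=
  Chart (R := R) (m := n.*2) (M := E) setT id id.

Lemma id_chart_img : cimg id_chart = setT.
Proof. by apply/seteqP; split=> // x _; exists x. Qed.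

Lemma id_chart_compat (c d : chart R n.*2 E) :
  [set id_chart] c -> [set id_chart] d ->
  smooth_on (cmap c @` (cdom c `&` cdom d)) (cmap d \o cinv c).
Proof. by move=> -> -> k; exact: Ck_id. Qed.

Lemma id_chart_is_chart (c : chart R n.*2 E) : [set id_chart] c -> is_chart c.
Proof.
move=> ->; split=> //=; first exact: openT.
- by rewrite id_chart_img; exact: openT.
- by move=> p _; exact: cvg_id.
- by move=> p _; exact: cvg_id.
Qed.

Definition euclidean : manifold R n.*2 :=
  @Manifold R n.*2 E [set id_chart] (fun=> id_chart)
    (@norm_hausdorff _ E) (@second_countable_row _) id_chart_is_chart
    id_chart_compat (fun=> erefl) (fun=> I).

Implicit Types (p u v : E) (i : 'I_(n.*2).+1).

(* Pairs the coordinates 2k + 1 and 2k + 2, and fixes the coordinate 0. *)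
Definition partner i : 'I_(n.*2).+1 :=
  inord (if i == 0 :> nat then 0%N else if odd i then i.+1 else i.-1).

Definition psign i : R := if i == 0 :> nat then 0 else if odd i then -1 else 1.

Lemma partnerE i : partner i =
  (if i == 0 :> nat then 0%N else if odd i then i.+1 else i.-1) :> nat.
Proof.
rewrite /partner inordK//; case: eqP => // i0; case: ifP => oi.
  (* An odd index differs from the last index 2n, which is even, so its successor is still an
     index. *)
  have := ltn_ord i; rewrite !ltnS leq_eqVlt => /orP[/eqP E0|//].
  by move: oi; rewrite E0 odd_double.
by apply: leq_ltn_trans (ltn_ord i); exact: leq_pred.
Qed.

Lemma partner0 i : i == 0 :> nat -> partner i = i.
Proof. by move=> i0; apply: val_inj; rewrite /= partnerE i0 (eqP i0). Qed.

Lemma partnerK : involutive partner.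
Proof.
move=> i; have [i0|i0] := boolP (i == 0 :> nat); first by rewrite !partner0.
apply: val_inj; rewrite /= !partnerE (negbTE i0).
have [oi|oi] := boolP (odd i); first by rewrite /= oi.
case: (i : nat) i0 oi => [//|[//|k]] _ /=.
by rewrite negbK => ->.
Qed.

Lemma psign_partner i : psign (partner i) = - psign i.
Proof.
rewrite /psign partnerE; have [i0|i0] := boolP (i == 0 :> nat); first by rewrite oppr0.
have [oi|oi] := boolP (odd i); first by rewrite /= oi opprK.
case: (i : nat) i0 oi => [//|[//|k]] _ /=.
by rewrite negbK => ->.
Qed.

Lemma psign_sqr i : psign i * psign i = (i != 0 :> nat)%:R.
Proof.
by rewrite /psign; case: eqP => _; [rewrite mul0r|case: ifP => _; rewrite ?mulrNN mulr1].
Qed.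

(** Multiplication by i, (x_k, y_k) |-> (-y_k, x_k), on each coordinate plane, and zero along z. *)
Definition J0 v : E := \row_i (psign i * v 0 (partner i)).

Definition dot u v : R := \sum_i u 0 i * v 0 i.

Definition e0 : E := delta_mx 0 ord0.

(* The contact form [dz + (1/2) sum_k (x_k dy_k - y_k dx_k)], where z is the
   coordinate 0 and x_k, y_k are the coordinates 2k + 1 and 2k + 2. *)
Definition std_lam (p : euclidean) v : R := v 0 ord0 - 2^-1 * dot p (J0 v).

Definition std_X (p : euclidean) : E := e0.

(* The lift to the contact planes of the complex structure [J0]. *)
Definition std_J (p : euclidean) v : E := J0 v + (2^-1 * dot p (J0 (J0 v))) *: e0.

Lemma dotZDr u k v w : dot u (k *: v + w) = k * dot u v + dot u w.
Proof.
rewrite /dot mulr_sumr -big_split; apply: eq_bigr => i _ /=.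
by rewrite !mxE; ring.
Qed.

Lemma dotZDl u k v w : dot (k *: v + w) u = k * dot v u + dot w u.
Proof.
rewrite /dot mulr_sumr -big_split; apply: eq_bigr => i _ /=.
by rewrite !mxE; ring.
Qed.

Lemma dotNr u v : dot u (- v) = - dot u v.
Proof. by rewrite /dot -sumrN; apply: eq_bigr => i _; rewrite mxE mulrN. Qed.

Lemma J0_linear k u v : J0 (k *: u + v) = k *: J0 u + J0 v.
Proof. by apply/rowP => i; rewrite !mxE; ring. Qed.

Lemma J0_0 : J0 0 = 0.
Proof. by apply/rowP => i; rewrite !mxE mulr0. Qed.

Lemma J0_e0 : J0 e0 = 0.
Proof.
apply/rowP => i; rewrite !mxE eqxx /=.
have [E1|ne] := eqVneq (partner i) ord0; last by rewrite mulr0.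
have i0 : i = ord0 by rewrite -(partnerK i) E1 partner0.
by rewrite i0 /psign /= mul0r.
Qed.

Lemma J0J0 v : J0 (J0 v) = - v + v 0 ord0 *: e0.
Proof.
apply/rowP => i; rewrite !mxE partnerK psign_partner mulrA mulrN psign_sqr eqxx /=.
have [-> | i0] := eqVneq i ord0; first by rewrite /= oppr0 mul0r mulr1 addNr.
by rewrite -val_eqE /= in i0; rewrite i0 mulN1r mulr0 addr0.
Qed.

(** Reindexing the sum by the involution [partner] flips [psign]. *)
Lemma dot_J0 u v : dot u (J0 v) = - dot v (J0 u).
Proof.
rewrite /dot -sumrN (reindex_inj (inv_inj partnerK)) /=.
by apply: eq_bigr => i _; rewrite !mxE partnerK psign_partner; ring.
Qed.

Lemma dot_e0 v : dot v e0 = v 0 ord0.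
Proof.
rewrite /dot (bigD1 ord0)//= big1 ?addr0; first by rewrite mxE !eqxx mulr1.
by move=> i i0; rewrite mxE (negbTE i0) mulr0.
Qed.

Lemma J0_coord0 v : J0 v 0 ord0 = 0.
Proof. by rewrite mxE /psign /= mul0r. Qed.

Lemma dotC u v : dot u v = dot v u.
Proof. by apply: eq_bigr => i _; rewrite mulrC. Qed.

Lemma tcomp_euclidean (p : euclidean) v : tcomp (id_chart : chart R n.*2 euclidean) p v = v.
Proof. exact: derive_id. Qed.

Lemma dmap_id_euclidean (p : E) v :
  dmap (cinv (id_chart : chart R n.*2 euclidean)) p v = v.
Proof. exact: derive_id. Qed.

Lemma pullback_id_euclidean (lam : euclidean -> E -> R) (p : E) v :
  pullback (cinv (id_chart : chart R n.*2 euclidean)) lam p v = lam p v.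
Proof. by rewrite /pullback dmap_id_euclidean. Qed.

Lemma std_lam_scalar p : scalar (std_lam p).
Proof.
by move=> k u v; rewrite /std_lam J0_linear dotZDr !mxE; ring.
Qed.

Lemma Ck_row_coord k (U : set E) i : open U -> Ck k U (fun x : E => x 0 i : R^o).
Proof. by move=> oU; apply: (@Ck_coord _ _ _ _ _ id) => //; exact: Ck_id. Qed.

Lemma Ck_dot k (U : set E) (v : E) : open U -> Ck k U (fun x : E => dot x v : R^o).
Proof.
move=> oU; apply: Ck_sum => // i; apply: CkM => //; last exact: Ck_cst.
exact: Ck_row_coord.
Qed.

(** The form is the sum of the dx_k ^ dy_k: [std_lam] is affine in the point, each of the two
    derivatives contributes half, and antisymmetry of [dot u (J0 v)] adds the halves. *)
Lemma std_dform (p : euclidean) u v : dform std_lam p u v = - dot u (J0 v).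
Proof.
have D (a b : E) : 'D_a (fun y : E =>
    pullback (cinv (id_chart : chart R n.*2 euclidean)) std_lam y b : R^o) p =
    - 2^-1 * dot a (J0 b).
  apply: derive_affine => h; rewrite !pullback_id_euclidean /std_lam dotZDl.
  apply: (@etrans _ _ (h * (- 2^-1 * dot a (J0 b)))) => //; ring.
have alg (x : R) : - 2^-1 * x - - 2^-1 * - x = - x.
  by apply: (@etrans _ _ (- (2^-1 * 2) * x)); [ring|rewrite mulVf ?mulN1r].
have E := etrans (congr2 (fun x y : R => x - y) (D u v) (D v u))
  (congr1 (fun x => - 2^-1 * dot u (J0 v) - - 2^-1 * x) (dot_J0 v u)).
exact: etrans E (alg _).
Qed.

Lemma dot0r u : dot u 0 = 0.
Proof. by rewrite /dot big1// => i _; rewrite mxE mulr0. Qed.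

Lemma std_lam_e0 p : std_lam p e0 = 1.
Proof. by rewrite /std_lam J0_e0 dot0r mulr0 subr0 mxE !eqxx. Qed.

Lemma std_JE p v : std_J p v = J0 v + (2^-1 * dot p (J0 (J0 v))) *: e0.
Proof. by []. Qed.

Lemma J0_std_J p v : J0 (std_J p v) = J0 (J0 v).
Proof. by rewrite /std_J addrC J0_linear J0_e0 scaler0 add0r. Qed.

(** The coefficient of [e0] in [std_J] is precisely the one that cancels the value of [std_lam] on
    [J0 v]. *)
Lemma std_lam_J p v : std_lam p (std_J p v) = 0.
Proof.
by rewrite /std_lam J0_std_J /std_J !mxE /psign !eqxx /= mul0r add0r mulr1 subrr.
Qed.

Lemma J0J0_dot v : (dot v (J0 (J0 v)) == 0) = (dot (J0 v) (J0 v) == 0).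
Proof. by rewrite dot_J0 oppr_eq0. Qed.

(** The quantity is minus the square norm of [J0 v]. If it vanishes, [v] is a multiple of [e0], and
    a multiple of [e0] in the kernel of [std_lam] is 0. *)
Lemma norm_xi_eq0 (p : euclidean) v : std_lam p v = 0 -> dot v (J0 (J0 v)) = 0 -> v = 0.
Proof.
move=> lv /eqP; rewrite J0J0_dot /dot psumr_eq0 => [/allP H|i _]; last first.
  by rewrite -expr2 sqr_ge0.
have Jv : J0 v = 0.
  apply/rowP => i; rewrite [RHS]mxE; apply/eqP.
  by have := H i (mem_index_enum _); rewrite /= mulf_eq0 orbb.
have := J0J0 v; rewrite Jv J0_0 => /eqP; rewrite eq_sym addrC subr_eq0 => /eqP <-.
by move: lv; rewrite /std_lam Jv dot0r mulr0 subr0 => ->; rewrite scale0r.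
Qed.

Lemma std_contact_form : contact_form std_lam.
Proof.
split.
- split=> [p|c -> v k]; first exact: std_lam_scalar.
  rewrite id_chart_img.
  apply: (@Ck_ext _ _ _ _ _ (fun x : E => v 0 ord0 + - 2^-1 * dot x (J0 v))) => //.
  + exact: openT.
  + by move=> x _; rewrite pullback_id_euclidean /std_lam mulNr.
  + apply: CkD; [exact: openT|exact: Ck_cst|].
    by apply: CkM; [exact: openT|exact: Ck_cst|apply: Ck_dot; exact: openT].
- by move=> p; exists e0; rewrite std_lam_e0 oner_neq0.
(* Nondegeneracy is tested against [std_J p v], which lies in the contact plane and gives the square
   norm of [J0 v]. *)
- move=> p v lv; move=> /(_ (std_J p v)); rewrite std_dform J0_std_J std_lam_J.
  move=> /(_ erefl)/eqP; rewrite oppr_eq0 => /eqP.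
  exact: (norm_xi_eq0 lv).
Qed.

Lemma std_reeb_field : reeb_field std_lam std_X.
Proof.
split=> [c -> k|p|p v]; last 2 first.
- exact: std_lam_e0.
- by rewrite std_dform dot_J0 J0_e0 dot0r !oppr0.
rewrite id_chart_img; apply: (@Ck_ext _ _ _ _ _ (fun=> e0)); first exact: openT.
  by move=> x _; rewrite tcomp_euclidean.
exact: Ck_cst.
Qed.

Lemma std_compatible_acs : compatible_acs std_lam std_X std_J.
Proof.
have gE (p : euclidean) u v : g_xi std_lam std_J p u v = - dot u (J0 (J0 v)).
  by rewrite /g_xi std_dform J0_std_J.
split.
- split=> [p k u v|c -> v k].
    rewrite /std_J !J0_linear dotZDr.
    by apply/rowP => i; rewrite !mxE; ring.
  rewrite id_chart_img.
  apply: (@Ck_ext _ _ _ _ _ (fun x : E => J0 v + (2^-1 * dot x (J0 (J0 v))) *: e0)).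
  + exact: openT.
  + by move=> x _; rewrite tcomp_euclidean dmap_id_euclidean.
  + apply: CkD; [exact: openT|exact: Ck_cst|].
    apply: Ck_row => [|i]; first exact: openT.
    under eq_fun do rewrite mxE.
    apply: CkM; [exact: openT| |exact: Ck_cst].
    by apply: CkM; [exact: openT|exact: Ck_cst|apply: Ck_dot; exact: openT].
- by move=> p; rewrite /std_J /std_X J0_e0 J0_0 dot0r mulr0 scale0r addr0.
- move=> p v lv; split; first exact: std_lam_J.
  rewrite (std_JE p (std_J p v)) J0_std_J (J0J0 (J0 v)) J0_coord0 scale0r addr0 J0J0.
  move: lv; rewrite /std_lam dotNr mulrN => /eqP; rewrite subr_eq0 => /eqP ->.
  by rewrite -addrA -scalerDl subrr scale0r addr0.
- move=> p u v lu lv; rewrite !gE !J0_std_J; split.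
    by rewrite (dot_J0 u) (dot_J0 v) !opprK dotC.
  rewrite (std_JE p u) addrC dotZDl (dotC e0) dot_e0 J0_coord0 mulr0 add0r.
  by rewrite (J0J0 (J0 v)) J0_coord0 scale0r addr0 dotNr (dot_J0 u) dotC.
- move=> p v lv v0; rewrite gE lt_neqAle; apply/andP; split.
    rewrite eq_sym oppr_eq0; apply: contra v0 => /eqP nv.
    by apply/eqP; exact: norm_xi_eq0 lv nv.
  by rewrite dot_J0 opprK; apply: sumr_ge0 => i _; rewrite -expr2 sqr_ge0.
Qed.

Lemma std_contact_triad : contact_triad std_lam std_X std_J.
Proof.
split; [exact: std_contact_form|exact: std_reeb_field|exact: std_compatible_acs].
Qed.

(** The z-axis run through at Reeb speed in tau and constant in t, so that T = 0 and Q = -1. *)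
Definition std_w (z : R^o * R^o) : euclidean := (z.1 : R) *: e0.

Lemma std_w_dmap (z v : R^o * R^o) : dmap std_w z v = (v.1 : R) *: e0.
Proof.
apply: derive_affine => h; rewrite /= /std_w.
by rewrite -scalerBl /= addrK scalerA.
Qed.

Lemma std_w_pullback (z v : R^o * R^o) : pullback std_w std_lam z v = v.1.
Proof.
by rewrite /pullback std_w_dmap (scalar_funZ _ _ (std_lam_scalar _)) std_lam_e0 mulr1.
Qed.

Lemma std_w_dpi (z v : R^o * R^o) : dpi std_lam std_X std_w z v = 0.
Proof.
rewrite /dpi /pi_xi -/(pullback std_w std_lam z v) std_w_pullback std_w_dmap.
exact: subrr.
Qed.

Lemma Ck_fst k (U : set (R^o * R^o)) : Ck k U (fun z => z.1 : R^o).
Proof.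
case: k => [|k]; first by move=> z _; exact: cvg_fst.
split=> [z _|v].
  exact: (@linear_differentiable R (R^o * R^o)%type R^o (@fst R^o R^o) z
    (fun _ => cvg_fst)).
rewrite (_ : (fun x => _) = (fun=> v.1)); first exact: Ck_cst.
by apply/funext => z; apply: derive_affine => h /=; rewrite addrK.
Qed.

Lemma std_w_smooth : smooth_cylinder_map std_w.
Proof.
split=> //; have C k : Ck k setT (std_w : R^o * R^o -> E).
  apply: Ck_row => [|i]; first exact: openT.
  apply: (@Ck_ext _ _ _ _ _ (fun z : R^o * R^o => (z.1 : R^o) * e0 0 i)).
  - exact: openT.
  - by move=> z _; rewrite [RHS]mxE.
  apply: (CkM openT (@Ck_fst k setT) (Ck_cst k setT (e0 0 i : R^o))).
split=> [z|c -> k]; first exact: (C 0%N z I).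
exact: Ck_sub (C k).
Qed.

Lemma std_w_instanton : contact_instanton std_lam std_X std_J std_w.
Proof.
split; first exact: std_w_smooth.
- move=> z v; rewrite /dbar_pi !std_w_dpi add0r.
  have [[lJ _] _ _ _ _] := std_compatible_acs.
  have := lJ (std_w z) (-1) 0 0; rewrite scaler0 addr0 scaleN1r addNr => ->.
  exact: scaler0.
- move=> z u v.
  have D (a b : R^o * R^o) :
      'D_a (fun y => pullback_j std_lam std_w y b : R^o) z = 0.
    by apply: derive_affine => h; rewrite /pullback_j !std_w_pullback subrr scaler0.
  exact: (etrans (congr2 (fun x y : R => x - y) (D u v) (D v u)) (subrr 0)).
Qed.

Lemma std_w_dpi_norm2 z : dpi_norm2 std_lam std_X std_J std_w z = 0.
Proof. by rewrite /dpi_norm2 !std_w_dpi !(g_xi0 std_contact_triad) addr0. Qed.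

Lemma std_w_bounded : bounded_gradient std_lam std_X std_J std_w.
Proof.
exists 1 => z.
have L (a : R^o * R^o) : std_lam (std_w z) (dmap std_w z a) = a.1 := std_w_pullback z a.
have P (a : R^o * R^o) : pi_xi std_lam std_X (std_w z) (dmap std_w z a) = 0 := std_w_dpi z a.
have key (a : R^o * R^o) : triad_metric std_lam std_X std_J (std_w z)
    (dmap std_w z a) (dmap std_w z a) = 0 + a.1 * a.1 :=
  congr2 +%R (etrans (congr2 (g_xi std_lam std_J (std_w z)) (P a) (P a))
    (g_xi0 std_contact_triad _)) (congr2 *%R (L a) (L a)).
have -> : dw_norm2 std_lam std_X std_J std_w z = (0 + 1 * 1) + (0 + 0 * 0) :=
  congr2 +%R (key (d_tau (R := R))) (key (d_t (R := R))).
by rewrite mul0r mulr1 !add0r addr0.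
Qed.

Lemma std_w_massless : massless std_lam std_X std_J std_w.
Proof.
rewrite /massless /pi_energy; under eq_integral do rewrite std_w_dpi_norm2.
by rewrite integral0 mule0.
Qed.

Lemma std_w_pullbackE (z v : R^o * R^o) : pullback std_w std_lam z v = v.1 * 1 + v.2 * 0.
Proof. by rewrite std_w_pullback mulr1 mulr0 addr0. Qed.

(** Along every integral curve the z-coordinate grows at rate 1, so no nonzero period is
    possible. *)
Lemma std_not_closed_leaf L : ~ closed_leaf std_X L.
Proof.
move=> [P [g [P0 [/integral_curveP[_ _ gX] gP] _]]].
have dg s : deriv (fun s => g s 0 ord0) s 1.
  have [[cg dg] gXs] := gX s Logic.I.
  have dgd : derivable (g : R^o -> E) s 1 by exact: diff_derivable.
  split; first by have /derivable_mxP := dgd; apply.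
  rewrite (derive_coord _ dgd).
  have -> : 'D_1 (g : R^o -> E) s = e0 by exact: gXs.
  by rewrite mxE !eqxx.
wlog Ppos : P P0 gP / 0 < P.
  move=> H; have [Pn|Pp] := ltP P 0; last first.
    by apply: (H P) => //; rewrite lt_neqAle eq_sym P0.
  apply: (H (- P)); rewrite ?oppr_eq0 ?oppr_gt0// => s.
  by rewrite -[in RHS](subrK P s) gP.
have [s _|c _] := @MVT_closed R (fun s => g s 0 ord0) (fun=> 1) 0 P (ltW Ppos).
  exact: dg.
rewrite -[P in g P]add0r gP subrr subr0 mulr1 => E1.
by move: P0; rewrite -E1 eqxx.
Qed.

End StandardContactSpace.

(** That a leaf need not be closed is an existence claim, hence the second conjunct; the example is
    available for every n. *)
Theorem proposition1p8 (R : realType) (n : nat) :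
  (forall (M : manifold R n.*2) (lam : M -> 'rV[R]_(n.*2).+1 -> R)
      (X : M -> 'rV[R]_(n.*2).+1)
      (J : M -> 'rV[R]_(n.*2).+1 -> 'rV[R]_(n.*2).+1)
      (w : R^o * R^o -> M) (T Q : R),
    contact_triad lam X J ->
    contact_instanton lam X J w ->
    bounded_gradient lam X J w ->
    massless lam X J w ->
    T = contact_action lam X J w ->
    Q = contact_charge lam w ->
    exists (L : set M) (I : set R) (gamma : R -> M),
      [/\ factors_through X w Q T L I gamma,
          T != 0 -> I = setT /\ closed_orbit X T gamma,
          T != 0 -> Q = 0 ->
            forall s tau t : R, w (tau + s, t) = w (tau, t) &
          T = 0 -> Q != 0 ->
            exists c : R -> M, immersion c /\ range c = L])
  /\
  (exists (M : manifold R n.*2) (lam : M -> 'rV[R]_(n.*2).+1 -> R)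
      (X : M -> 'rV[R]_(n.*2).+1)
      (J : M -> 'rV[R]_(n.*2).+1 -> 'rV[R]_(n.*2).+1)
      (w : R^o * R^o -> M),
    [/\ contact_triad lam X J,
        contact_instanton lam X J w,
        bounded_gradient lam X J w,
        massless lam X J w &
        [/\ contact_action lam X J w = 0,
            contact_charge lam w != 0 &
            exists (L : set M) (I : set R) (gamma : R -> M),
              factors_through X w (contact_charge lam w)
                (contact_action lam X J w) L I gamma /\
              ~ closed_leaf X L]]).
Proof.
split.
  move=> M lam X J w T Q; exact: massless_instanton_orbit.
(* The first part, applied to the example, provides the leaf; as no leaf of [std_X] is closed, it
   need not be identified. *)
have [L [I [g [fac _ _ _]]]] := massless_instanton_orbit (@std_contact_triad R n)
  (@std_w_instanton R n) (@std_w_bounded R n) (@std_w_massless R n) erefl erefl.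
exists (euclidean n), (@std_lam R n), (@std_X R n), (@std_J R n), (@std_w R n).
split.
- exact: std_contact_triad.
- exact: std_w_instanton.
- exact: std_w_bounded.
- exact: std_w_massless.
- split.
  + exact: (instanton_action (@std_w_dpi_norm2 R n) (@std_w_pullbackE R n)).
  + by rewrite (instanton_charge (@std_w_pullbackE R n)) oppr_eq0 oner_neq0.
  + by exists L, I, g; split=> //; exact: std_not_closed_leaf.
Qed.
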